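(* Let $\alpha\in(0,1]$ and suppose that the envelope conditions, the Hölder stability condition and the parameter compactness condition of the context are satisfied. (1) For every $r,T\ge0$, $n\in\mathbb N$, $\alpha'\in[0,\alpha)$ and $\varepsilon>0$, there exists $\Phi_n\in\mathcal{EN}^{\mathrm{ReLU}}_{C_\kappa,C_\kappa}$ with $$\sup_{f\in B_{C^\alpha_\kappa}(r)}\ \sup_{t\in[0,T]}\|I(\pi_n^t)f-\Phi(\pi_n^t)f\|_{\alpha',\kappa}<\varepsilon .$$ (2) Let $(S(t))_{t\ge0}$ be the semigroup on $C_\kappa$ given by $S(t)f=\lim_{n\to\infty}I(\pi_n^t)f$. Then, for every $r,T\ge0$, $\alpha'\in[0,\alpha)$, every bounded continuous $\kappa':\mathbb R^d\to(0,\infty)$ with $\kappa'\ll\kappa$ and every $\varepsilon>0$, there exist $n\in\mathbb N$ and $\Phi_n\in\mathcal{EN}^{\mathrm{ReLU}}_{C_\kappa,C_\kappa}$ with $$\sup_{f\in B_{C^\alpha_\kappa}(r)}\ \sup_{t\in[0,T]}\|S(t)f-\Phi(\pi_n^t)f\|_{\alpha',\kappa'}<\varepsilon .$$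
   Context: **Function spaces.** $|\cdot|$ is the Euclidean norm on $\mathbb R^d$. $\kappa:\mathbb R^d\to(0,\infty)$ is bounded continuous with $\sup_x\sup_{|y|\le1}\kappa(x)/\kappa(x-y)<\infty$. $C_\kappa$ is the space of continuous $f:\mathbb R^d\to\mathbb R$ with $\|f\|_\kappa:=\sup_x|f(x)|\kappa(x)<\infty$, ordered pointwise and endowed with the mixed topology (strongest locally convex topology coinciding on $\|\cdot\|_\kappa$-bounded sets with uniform convergence on compacts); $f_n\to f$ in it iff $\sup_n\|f_n\|_\kappa<\infty$ and $\|f-f_n\|_{\infty,K}:=\sup_{K}|f-f_n|\to0$ for all compact $K\subset\mathbb R^d$. All limits in $C_\kappa$ are in this sense. Put $\bar\kappa(x,y):=\frac{2\kappa(x)\kappa(y)}{\kappa(x)+\kappa(y)}$. For $\alpha\in[0,1]$, $$\|f\|_{\alpha,\kappa}:=\max\Big\{\sup_x|f(x)|\kappa(x),\ \sup_{x\ne y}\frac{|f(x)-f(y)|}{|x-y|^\alpha}\bar\kappa(x,y)\Big\},$$ $C^\alpha_\kappa$ is the space of $f:\mathbb R^d\to\mathbb R$ with $\|f\|_{\alpha,\kappa}<\infty$ (with $C^0_\kappa=C_\kappa$ as sets), and $B_{C^\alpha_\kappa}(r)$, $B_{C_\kappa}(r)$ are the closed balls of radius $r$ for $\|\cdot\|_{\alpha,\kappa}$, $\|\cdot\|_\kappa$. The norm $\|\cdot\|_{\alpha',\kappa'}$ is defined in the same way for other weights $\kappa'$. $\kappa'\ll\kappa$ means $\lim_{|x|\to\infty}\kappa'(x)/\kappa(x)=0$.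 $\mathrm{Lip}_b(r)$ is the set of $r$-Lipschitz $f:\mathbb R^d\to\mathbb R$ with $\|f\|_\infty\le r$; $C_b^\infty$ is the space of bounded smooth functions with all derivatives bounded; $(\tau_xf)(y):=f(x+y)$; $B_{\mathbb R^d}(\delta):=\{|x|\le\delta\}$. **Operators.** $\Lambda$ is an index set, $I_{n,\lambda}:C_\kappa\to C_\kappa$ ($n\in\mathbb N,\lambda\in\Lambda$) are operators, $\eta,\eta_n:\Lambda\to[0,\infty]$, and $(h_n)\subset(0,\infty)$ with $h_n\to0$. Define $(I_nf)(x):=\sup_{\lambda\in\Lambda}\big((I_{n,\lambda}f)(x)-\eta_n(\lambda)h_n\big)$. Let $A_\lambda f:=\lim_{n\to\infty}\frac{I_{n,\lambda}f-f}{h_n}$ with domain $D(A_\lambda)$ the set of $f\in C_\kappa$ for which the limit exists, and $I'(0)f:=\lim_{n\to\infty}\frac{I_nf-f}{h_n}$ when it exists in $C_\kappa$. For $t\ge0$: $k_n^t:=\max\{k\in\mathbb N_0:kh_n\le t\}$, $I(\pi_n^t)f:=I_n^{k_n^t}f$ and $\Phi(\pi_n^t)f:=\Phi_n^{k_n^t}f$. Suprema of functions are pointwise. **Envelope conditions.** Either (i)–(vii), or (i)–(vi) and (vii'), hold: (i) for every $n$ there is $\lambda_{0,n}\in\Lambda$ with $\eta_n(\lambda_{0,n})=0$; (ii) all $I_{n,\lambda}$ are linear and monotone; (iii) there is $\omega\ge0$ with $\|I_{n,\lambda}f\|_\kappa\le e^{\omega h_n}\|f\|_\kappa$ for all $n,\lambda$,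 $f\in C_\kappa$; (iv) for every $\varepsilon>0$ there are $\delta>0$, $n_0\in\mathbb N$ with $I_{n,\lambda}(\tau_xf)\le\tau_x(I_{n,\lambda}f)+\frac{r\varepsilon h_n}{\kappa}$ for all $n\ge n_0$, $r\ge0$, $f\in\mathrm{Lip}_b(r)$, $x\in B_{\mathbb R^d}(\delta)$, $\lambda\in\Lambda$; (v) for all $\varepsilon>0$, $r,T\ge0$, compact $K\subset\mathbb R^d$ there are $c\ge0$ and compact $K'\subset\mathbb R^d$ with $\|I(\pi_n^t)f-I(\pi_n^t)g\|_{\infty,K}\le c\|f-g\|_{\infty,K'}+\varepsilon$ for all $t\in[0,T]$, $n\in\mathbb N$, $f,g\in B_{C_\kappa}(r)$; (vi) $I_{n,\lambda}:\mathrm{Lip}_b(r)\to\mathrm{Lip}_b(e^{\omega h_n}r)$ for all $n,\lambda$, $r\ge0$; (vii) $I'(0)f\in C_\kappa$ exists for all $f\in C_b^\infty$; (vii') $C_b^\infty\subset D(A_\lambda)$ for all $\lambda$, and for every $f\in C_b^\infty$ there are $c\ge0$, $n_0\in\mathbb N$, $\Lambda_0\subset\Lambda$ such that: (a) $\sup_{\lambda\in\Lambda}(I_{n,\lambda}f-\eta_n(\lambda)h_n)=\sup_{\lambda\in\Lambda_0}(I_{n,\lambda}f-\eta_n(\lambda)h_n)$ for all $n\ge n_0$; (b) $\sup_{\lambda\in\Lambda}(A_\lambda f-\eta(\lambda))=\sup_{\lambda\in\Lambda_0}(A_\lambda f-\eta(\lambda))$; (c) $\sup_n\sup_{\lambda\in\Lambda_0}\eta_n(\lambda)<\infty$,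 $\sup_{\lambda\in\Lambda_0}\|I_{n,\lambda}f-f\|_\kappa\le ch_n$ for $n\ge n_0$, $\lim_{n}\sup_{\lambda\in\Lambda_0}\big\|\frac{I_{n,\lambda}f-f}{h_n}-A_\lambda f\big\|_{\infty,K}=0$ for all compact $K$, and $\lim_n\sup_{\lambda\in\Lambda_0}|\eta_n(\lambda)-\eta(\lambda)|=0$. Under the envelope conditions, the limit $S(t)f=\lim_{n\to\infty}I(\pi_n^t)f$ exists for all $t\ge0$, $f\in C_\kappa$ and defines a strongly continuous convex monotone semigroup on $C_\kappa$ (this may be taken as known). **Hölder stability condition.** $\|I_{n,\lambda}f\|_{\alpha,\kappa}\le e^{\omega h_n}\|f\|_{\alpha,\kappa}$ for all $n\in\mathbb N$, $\lambda\in\Lambda$, $f\in C^\alpha_\kappa$. **Parameter compactness condition.** For every $r\ge0$ there is a totally bounded metric space $(\Lambda_r,d_r)$ with $\Lambda_r\subset\Lambda$ such that $\Lambda_{r,n}:=\Lambda_r\cap\{\eta_n<\infty\}$ satisfies $\sup_{\lambda\in\Lambda}(I_{n,\lambda}f-\eta_n(\lambda)h_n)=\sup_{\lambda\in\Lambda_{r,n}}(I_{n,\lambda}f-\eta_n(\lambda)h_n)$ for all $n\in\mathbb N$, $f\in B_{C^\alpha_\kappa}(r)$. For every $r\ge0$, $\varepsilon>0$ there is $\delta>0$ with $\|(I_{n,\lambda_1}f-\eta_n(\lambda_1)h_n)-(I_{n,\lambda_2}f-\eta_n(\lambda_2)h_n)\|_\kappa<\varepsilon$ for all $n\in\mathbb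 N$, $f\in B_{C^\alpha_\kappa}(r)$ and $\lambda_1,\lambda_2\in\Lambda_{r,n}$ with $d_r(\lambda_1,\lambda_2)<\delta$. Moreover $\lambda_{0,n}\in\Lambda_r$ for all $n\in\mathbb N$. **Envelope-neural operators.** For $n\in\mathbb N$, an envelope-neural operator is a map $\Phi_n:C_\kappa\to C_\kappa$, $f\mapsto\varphi\big((I_{n,\lambda_0}f)(\cdot),(I_{n,\lambda_1}f)(\cdot),\dots,(I_{n,\lambda_M}f)(\cdot)\big)$ with $M\in\mathbb N$, $\lambda_0:=\lambda_{0,n}$, $\lambda_1,\dots,\lambda_M\in\Lambda$, and $\varphi:\mathbb R^{M+1}\to\mathbb R$ a feedforward ReLU neural network (finite composition of affine maps and coordinatewise ReLU $s\mapsto\max(s,0)$). The set of all of these is $\mathcal{EN}^{\mathrm{ReLU}}_{C_\kappa,C_\kappa}$. *)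

(* Defs.v *)
From HB Require Import structures.
From mathcomp Require Import all_boot all_order all_algebra.
From mathcomp Require Import all_classical all_reals all_analysis.

Set Implicit Arguments.
Unset Strict Implicit.
Unset Printing Implicit Defensive.

Import Order.TTheory GRing.Theory Num.Theory.
Import numFieldNormedType.Exports.

Local Open Scope classical_set_scope.
Local Open Scope ring_scope.

Section FunctionSpaces.
Context {R : realType} {d : nat}.
Local Notation E := 'rV[R]_d.

(* The library norm on row vectors is the max norm (same topology). *)
Definition enorm (x : E) : R := Num.sqrt (\sum_i x 0 i ^+ 2).

Definition bounded_weight (kappa : E -> R) : Prop :=
  [/\ continuous kappa, forall x, 0 < kappa x & exists C, forall x, kappa x <= C].

Definition shift_bounded (kappa : E -> R) : Prop :=
  exists C, forall x y : E, enorm y <= 1 -> kappa x / kappa (x - y) <= C.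

Definition weight_ll (kappa' kappa : E -> R) : Prop :=
  forall e : R, 0 < e ->
    exists M : R, forall x : E, M < enorm x -> `|kappa' x / kappa x| < e.

(* All (semi)norms are extended-real suprema, so that an infinite value is not
   confused with a finite one. *)
Definition wnorm (kappa f : E -> R) : \bar R :=
  ereal_sup [set (`|f x| * kappa x)%:E | x in [set: E]].

(* The maximum with 0 only matters for K = set0, where ereal_sup is -oo. *)
Definition supnorm (K : set E) (f : E -> R) : \bar R :=
  maxe 0%E (ereal_sup [set `|f x|%:E | x in K]).

Definition Ck (kappa : E -> R) : set (E -> R) :=
  [set f | continuous f /\ (wnorm kappa f < +oo)%E].

Definition ball_Ck (kappa : E -> R) (r : R) : set (E -> R) :=
  [set f | Ck kappa f /\ (wnorm kappa f <= r%:E)%E].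

(* Sequential convergence in C_kappa for the mixed topology. *)
Definition mixed_cvg (kappa : E -> R) (u : nat -> E -> R) (g : E -> R) : Prop :=
  [/\ forall n, Ck kappa (u n), Ck kappa g,
      (ereal_sup [set wnorm kappa (u n) | n in [set: nat]] < +oo)%E &
      forall K : set E, compact K ->
        (fun n => supnorm K (g \- u n)) @ \oo --> 0%E].

Definition kbar (kappa : E -> R) (x y : E) : R :=
  2 * kappa x * kappa y / (kappa x + kappa y).

Definition hoelder_norm (alpha : R) (kappa f : E -> R) : \bar R :=
  maxe (wnorm kappa f)
       (ereal_sup [set (`|f p.1 - f p.2| / enorm (p.1 - p.2) `^ alpha
                        * kbar kappa p.1 p.2)%:E | p in [set p : E * E | p.1 <> p.2]]).

(* For alpha = 0, finiteness of the norm does not give continuity, which the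
   convention C^0_kappa = C_kappa requires. *)
Definition Calpha (alpha : R) (kappa : E -> R) : set (E -> R) :=
  [set f | (alpha = 0 -> continuous f) /\ (hoelder_norm alpha kappa f < +oo)%E].

Definition ball_Calpha (alpha : R) (kappa : E -> R) (r : R) : set (E -> R) :=
  [set f | Calpha alpha kappa f /\ (hoelder_norm alpha kappa f <= r%:E)%E].

Definition Lipb (r : R) : set (E -> R) :=
  [set f | (forall x y, `|f x - f y| <= r * enorm (x - y)) /\
           (forall x, `|f x| <= r)].

Definition tau (x : E) (f : E -> R) : E -> R := fun y => f (x + y).

(* Iterated partial derivative along the coordinates listed in s. *)
Fixpoint pderiv (s : seq 'I_d) (f : E -> R) : E -> R :=
  if s is i :: s' then fun x => 'D_(delta_mx 0 i : E) (pderiv s' f) x else f.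

(* C_b^infty: all partial derivatives (f itself for s = [::]) exist, are
   continuous and are bounded. *)
Definition Cbinfty : set (E -> R) :=
  [set f | forall s : seq 'I_d,
     [/\ continuous (pderiv s f),
         forall (i : 'I_d) (x : E), derivable (pderiv s f) x (delta_mx 0 i : E) &
         exists C, forall x, `|pderiv s f x| <= C]].

End FunctionSpaces.

Section Operators.
Context {R : realType} {d : nat} {Lambda : Type}.
Local Notation E := 'rV[R]_d.
Variables (kappa : E -> R) (I : nat -> Lambda -> (E -> R) -> (E -> R))
  (etan : nat -> Lambda -> \bar R) (eta : Lambda -> \bar R) (h : nat -> R)
  (lambda0 : nat -> Lambda) (omega : R).

(* The operators on C_kappa are total maps on functions; only their values on
   C_kappa are ever constrained or used. *)
Definition maps_Ck (A : (E -> R) -> (E -> R)) : Prop :=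
  forall f, Ck kappa f -> Ck kappa (A f).

Definition env_sup (L : set Lambda) (n : nat) (f : E -> R) (x : E) : \bar R :=
  ereal_sup [set ((I n l f x)%:E - etan n l * (h n)%:E)%E | l in L].

(* Under the envelope conditions the supremum is finite for f in C_kappa. *)
Definition Iop (n : nat) (f : E -> R) : E -> R :=
  fun x => fine (env_sup setT n f x).

Definition nsteps (n : nat) (t : R) : nat := Num.truncn (t / h n).

Lemma nsteps_max (n : nat) (t : R) (k : nat) :
  0 < h n -> 0 <= t -> (k <= nsteps n t)%N = (k%:R * h n <= t).
Proof.
move=> h0 t0; have q0 : 0 <= t / h n by rewrite divr_ge0// ltW.
by rewrite -ler_pdivlMr// /nsteps truncn_ge_nat.
Qed.

Definition iter_pi (A : (E -> R) -> (E -> R)) (n : nat) (t : R) (f : E -> R) :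
  E -> R := iter (nsteps n t) A f.

Definition diff_quot (A : (E -> R) -> (E -> R)) (n : nat) (f : E -> R) : E -> R :=
  fun x => (A f x - f x) / h n.

Definition is_gen (l : Lambda) (f g : E -> R) : Prop :=
  mixed_cvg kappa (fun n => diff_quot (I n l) n f) g.

Definition gen_dom (l : Lambda) : set (E -> R) :=
  [set f | Ck kappa f /\ exists g, is_gen l f g].

Definition gen (l : Lambda) (f : E -> R) : E -> R := get (is_gen l f).

Record envelope_common : Prop := EnvelopeCommon {
  env_zero : forall n, etan n (lambda0 n) = 0%E;
  env_linear : forall n l (a : R) f g, Ck kappa f -> Ck kappa g ->
    forall x, I n l (fun y => a * f y + g y) x = a * I n l f x + I n l g x;
  env_monotone : forall n l f g, Ck kappa f -> Ck kappa g ->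
    (forall x, f x <= g x) -> forall x, I n l f x <= I n l g x;
  env_omega : 0 <= omega;
  env_growth : forall n l f, Ck kappa f ->
    (wnorm kappa (I n l f) <= (expR (omega * h n))%:E * wnorm kappa f)%E;
  env_shift : forall e : R, 0 < e -> exists (delta : R) (n0 : nat), 0 < delta /\
    forall n (r : R) f (x : E) l, (n0 <= n)%N -> 0 <= r -> Lipb r f ->
      enorm x <= delta ->
      forall y, I n l (tau x f) y <= tau x (I n l f) y + r * e * h n / kappa y;
  env_local : forall (e r T : R) (K : set E),
    0 < e -> 0 <= r -> 0 <= T -> compact K ->
    exists (c : R) (K' : set E), [/\ 0 <= c, compact K' &
      forall t n f g, 0 <= t <= T -> ball_Ck kappa r f -> ball_Ck kappa r g ->
        (supnorm K (iter_pi (Iop n) n t f \- iter_pi (Iop n) n t g)%R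
         <= c%:E * supnorm K' (f \- g)%R + e%:E)%E];
  env_lip : forall n l (r : R) f, 0 <= r -> Lipb r f ->
    Lipb (expR (omega * h n) * r) (I n l f)
}.

Definition envelope_derivative : Prop :=
  forall f, Cbinfty f ->
    exists g, mixed_cvg kappa (fun n => diff_quot (Iop n) n f) g.

Definition envelope_generators : Prop :=
  (forall l, Cbinfty `<=` gen_dom l) /\
  forall f, Cbinfty f -> exists (c : R) (n0 : nat) (L0 : set Lambda),
    0 <= c /\
    (forall n x, (n0 <= n)%N -> env_sup setT n f x = env_sup L0 n f x) /\
    (forall x, ereal_sup [set ((gen l f x)%:E - eta l)%E | l in [set: Lambda]]
             = ereal_sup [set ((gen l f x)%:E - eta l)%E | l in L0]) /\
    (ereal_sup [set ereal_sup [set etan n l | l in L0] | n in [set: nat]]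
       < +oo)%E /\
    (forall n, (n0 <= n)%N ->
       (ereal_sup [set wnorm kappa (I n l f \- f)%R | l in L0] <= (c * h n)%:E)%E) /\
    (forall K : set E, compact K ->
       (fun n => ereal_sup
          [set supnorm K (diff_quot (I n l) n f \- gen l f) | l in L0])
         @ \oo --> 0%E) /\
    (fun n => ereal_sup [set `|etan n l - eta l|%E | l in L0]) @ \oo --> 0%E.

Definition envelope_conditions : Prop :=
  envelope_common /\ (envelope_derivative \/ envelope_generators).

Definition hoelder_stable (alpha : R) : Prop :=
  forall n l f, Calpha alpha kappa f ->
    (hoelder_norm alpha kappa (I n l f)
     <= (expR (omega * h n))%:E * hoelder_norm alpha kappa f)%E.

Definition metric_on (L : set Lambda) (dist : Lambda -> Lambda -> R) : Prop :=
  [/\ forall x y, L x -> L y -> 0 <= dist x y,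
      forall x y, L x -> L y -> (dist x y = 0 <-> x = y),
      forall x y, L x -> L y -> dist x y = dist y x &
      forall x y z, L x -> L y -> L z -> dist x z <= dist x y + dist y z].

Definition totally_bounded_on (L : set Lambda) (dist : Lambda -> Lambda -> R) :
    Prop :=
  forall e : R, 0 < e -> exists F : set Lambda, [/\ finite_set F, F `<=` L &
    forall x, L x -> exists2 y, F y & dist x y < e].

Definition parameter_compact (alpha : R) : Prop :=
  forall r : R, 0 <= r ->
  exists (Lr : set Lambda) (dist : Lambda -> Lambda -> R),
    let Lrn n := Lr `&` [set l | (etan n l < +oo)%E] in
    [/\ metric_on Lr dist /\ totally_bounded_on Lr dist,
        forall n f x, ball_Calpha alpha kappa r f ->
          env_sup setT n f x = env_sup (Lrn n) n f x,
        forall e : R, 0 < e -> exists2 delta : R, 0 < delta &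
          forall n f l1 l2, ball_Calpha alpha kappa r f ->
            Lrn n l1 -> Lrn n l2 -> dist l1 l2 < delta ->
            (wnorm kappa (fun x => ((I n l1 f x - fine (etan n l1) * h n)
                                 - (I n l2 f x - fine (etan n l2) * h n))%R) < e%:E)%E &
        forall n, Lr (lambda0 n)].

End Operators.

Section Networks.
Context {R : realType}.

(* Feedforward ReLU networks R^m -> R^k. *)
Inductive relu_network : forall m k : nat, ('rV[R]_m -> 'rV[R]_k) -> Prop :=
| relu_affine m k (A : 'M[R]_(m, k)) (b : 'rV[R]_k) :
    relu_network (fun x : 'rV[R]_m => x *m A + b)
| relu_activation m :
    relu_network (fun x : 'rV[R]_m => map_mx (fun s => Num.max s 0) x)
| relu_comp m k p (phi : 'rV[R]_m -> 'rV[R]_k) (psi : 'rV[R]_k -> 'rV[R]_p) :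
    relu_network phi -> relu_network psi -> relu_network (psi \o phi).

(* Coordinate 0 of the network input carries lambda_{0,n}, coordinate j + 1
   carries the j-th of the M further parameters. *)
Definition envelope_neural {d : nat} {Lambda : Type} (kappa : 'rV[R]_d -> R)
    (I : nat -> Lambda -> ('rV[R]_d -> R) -> ('rV[R]_d -> R))
    (lambda0 : nat -> Lambda) (n : nat)
    (Phi : ('rV[R]_d -> R) -> ('rV[R]_d -> R)) : Prop :=
  maps_Ck kappa Phi /\
  exists (M : nat) (lam : 'I_M -> Lambda) (phi : 'rV[R]_M.+1 -> 'rV[R]_1),
    [/\ (0 < M)%N, relu_network phi &
      forall f, Ck kappa f -> forall x,
        Phi f x = phi (\row_(j < M.+1)
                        I n (if unlift ord0 j is Some j' then lam j'
                             else lambda0 n) f x) 0 0].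

End Networks.

(* Main.v *)
Require Import Defs.
From HB Require Import structures.
From mathcomp Require Import all_boot all_order all_algebra.
From mathcomp Require Import all_classical all_reals all_analysis.
From mathcomp Require Import ring lra.

Set Implicit Arguments.
Unset Strict Implicit.
Unset Printing Implicit Defensive.

Import Order.TTheory GRing.Theory Num.Theory.
Import numFieldNormedType.Exports.

Local Open Scope classical_set_scope.
Local Open Scope ring_scope.

(**
The one-step operator is a pointwise supremum of penalised linear operators.
Suprema do not increase distances, so it inherits from the linear operators the
growth bound in the weighted Hoelder norm ([envelope_hle]) and the Lipschitz bound
in the weighted supremum norm ([envelope_sub_wle]), both with factor
[expR (omega * h n)].

Fixed step size. On a Hoelder ball the supremum can be taken over a totally bounded
set of parameters, and it depends on the parameter equicontinuously. The maximum
over a finite net that contains [lambda0 n] is therefore uniformly close to the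
one-step operator in the weighted supremum norm ([one_step_approx]), and a maximum
of finitely many affine functions is a ReLU network ([relu_network_max_affine]).
The finite maximum satisfies the same growth bound, so all iterates up to time [T]
stay in one Hoelder ball, where the one-step error accumulates in a controlled way
([iter_error]). Splitting the difference quotients at a small distance turns
smallness in the weighted supremum norm, on a ball of the [alpha]-norm, into
smallness in the [alpha']-norm ([hle_interpolation]). This gives the first claim
([neural_approx]).

Semigroup. The iterates are shown to converge uniformly on compact sets, on the
Hoelder ball and on [0, T] ([uniform_convergence]). Up to a small error on a given
compact set, the Hoelder ball is represented by finitely many smooth bounded
functions that lie in a slightly larger ball of the weighted space
([finite_smooth_family]). They are Bernstein polynomials of the truncated functions
in the coordinatewise logistic variables, with values at the nodes rounded to a
finite grid; polynomials in the logistic functions of the coordinates are bounded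
and form an algebra stable under partial derivatives ([logistic_alg_Cbinfty]). The
continuity of the iterates on bounded sets, uniform in time and step size, allows to
pass from a function to its representative. On a smooth function one step costs at
most a multiple of the step size ([smooth_step_rate]), so the iterates are
equicontinuous in time up to one step ([smooth_time_regularity]), and it suffices to
know convergence at finitely many times for finitely many functions.

The limits inherit the Hoelder bound of the iterates. A dominated weight makes the
differences uniformly small far away, and the interpolation above gives convergence
in the weaker Hoelder norm ([hoelder_convergence]). The second claim follows by
choosing [n] large and then a network for this [n] by the first claim.
*)

(** * Euclidean norm and small powers *)

Section EuclideanNorm.
Context {R : realType} {d : nat}.
Local Notation E := 'rV[R]_d.

Lemma enorm_ge0 (x : E) : 0 <= enorm x.
Proof. exact: sqrtr_ge0. Qed.

Lemma coord_le_enorm (x : E) i : `|x 0 i| <= enorm x.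
Proof.
rewrite -sqrtr_sqr /enorm ler_sqrt ?sumr_ge0// => [|j _]; last exact: sqr_ge0.
by rewrite (bigD1 i)//= lerDl sumr_ge0// => j _; exact: sqr_ge0.
Qed.

Lemma normr_le_enorm (x : E) : `|x| <= enorm x.
Proof.
rewrite /Num.norm/= mx_normrE; apply: bigmax_le; first exact: enorm_ge0.
by move=> -[i j] _ /=; rewrite (ord1 i) coord_le_enorm.
Qed.

Lemma enorm_le_coord (x : E) (m : R) :
  0 <= m -> (forall i, `|x 0 i| <= m) -> enorm x <= d%:R * m.
Proof.
move=> m0 xm; rewrite -[leRHS]ger0_norm ?mulr_ge0// -sqrtr_sqr.
rewrite ler_wsqrtr//.
apply: (@le_trans _ _ (\sum_(i < d) m ^+ 2)).
  by apply: ler_sum => i _; rewrite -real_normK ?num_real// lerXn2r ?nnegrE.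
rewrite sumr_const card_ord -[leLHS]mulr_natl exprMn ler_wpM2r ?sqr_ge0//.
by rewrite -natrX ler_nat; case: d => // k; rewrite leq_pmulr.
Qed.

Lemma coord_le_normr (x : E) i : `|x 0 i| <= `|x|.
Proof.
rewrite {2}/Num.norm/= mx_normrE.
by apply/bigmax_geP; right; exists (0, i).
Qed.

Lemma enorm_le_normr (x : E) : enorm x <= d%:R * `|x|.
Proof. by apply: enorm_le_coord => // i; exact: coord_le_normr. Qed.

Lemma enorm_gt0 (x : E) : x <> 0 -> 0 < enorm x.
Proof.
move=> /eqP x0; apply: lt_le_trans (normr_le_enorm x).
by rewrite normr_gt0.
Qed.

Lemma powR_small (alpha C e : R) : 0 < alpha -> 0 <= C -> 0 < e ->
  exists2 rho : R, 0 < rho & forall t, 0 <= t <= rho -> C * t `^ alpha <= e.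
Proof.
move=> a0 C0 e0; have C1 : 0 < C + 1 by lra.
have q0 : 0 < e / (C + 1) by rewrite divr_gt0.
exists ((e / (C + 1)) `^ alpha^-1); first by rewrite powR_gt0.
move=> t /andP[t0 tr]; apply: (@le_trans _ _ ((C + 1) * (e / (C + 1)))); last first.
  by rewrite mulrC divfK// gt_eqF.
apply: ler_pM => //; rewrite ?powR_ge0//; first lra.
have -> : e / (C + 1) = ((e / (C + 1)) `^ alpha^-1) `^ alpha.
  by rewrite -powRrM mulVf ?gt_eqF// powRr1// ltW.
by apply: ge0_ler_powR; rewrite ?nnegrE ?powR_ge0// ltW.
Qed.

End EuclideanNorm.

(** * Weighted supremum and Hoelder norms as real bounds *)

Section WeightedNorms.
Context {R : realType} {d : nat}.
Local Notation E := 'rV[R]_d.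
Implicit Types (kappa f g : E -> R).

(** [wle kappa f c] says that the weighted supremum norm of [f] is at most the
    real number [c]. *)
Definition wle kappa f (c : R) := forall x, `|f x| * kappa x <= c.

(** [hle alpha kappa f c] says that the weighted Hoelder norm of [f] is at most
    the real number [c]. Multiplying out the difference quotient allows [x = y],
    where the second bound only says that its right-hand side is nonnegative. *)
Definition hle (alpha : R) kappa f (c : R) := wle kappa f c /\
  forall x y, `|f x - f y| * kbar kappa x y <= c * enorm (x - y) `^ alpha.

Lemma wnorm_leP kappa f c : (wnorm kappa f <= c%:E)%E <-> wle kappa f c.
Proof.
split=> [H x|H].
  by rewrite -lee_fin; apply: le_trans H; apply: ereal_sup_ubound; exists x.
by apply: ge_ereal_sup => _ [x _ <-]; rewrite lee_fin.
Qed.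

Lemma kbar_gt0 kappa x y : (forall z, 0 < kappa z) -> 0 < kbar kappa x y.
Proof. by move=> k0; rewrite /kbar divr_gt0// ?addr_gt0// !mulr_gt0. Qed.

Lemma kbar_ge_min kappa x y m : 0 < m -> m <= kappa x -> m <= kappa y ->
  m <= kbar kappa x y.
Proof.
move=> m0 mx my; rewrite /kbar ler_pdivlMr; last by apply: addr_gt0; lra.
rewrite [leRHS]mulrAC; nra.
Qed.

Lemma kbar_le_double kappa x y : (forall z, 0 < kappa z) ->
  kbar kappa x y <= 2 * kappa x.
Proof.
move=> k0; rewrite /kbar ler_pdivrMr ?addr_gt0// ler_wpM2l ?lerDr ?ltW// mulr_gt0//.
Qed.

(** [kbar] is the harmonic mean of two values of the weight, hence monotone and
    homogeneous in the weight. *)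
Lemma kbar_scale_le kappa' kappa (C : R) x y : 0 < C ->
  (forall z, 0 < kappa z) -> (forall z, 0 < kappa' z) ->
  (forall z, kappa' z <= C * kappa z) -> kbar kappa' x y <= C * kbar kappa x y.
Proof.
move=> C0 k0 k0' kk.
have a0 := k0 x; have b0 := k0 y; have a0' := k0' x; have b0' := k0' y.
have ha := kk x; have hb := kk y; rewrite /kbar.
set a := kappa x in a0 ha *; set b := kappa y in b0 hb *.
set a' := kappa' x in a0' ha *; set b' := kappa' y in b0' hb *.
rewrite mulrA ler_pdivrMr ?addr_gt0// [leRHS]mulrAC ler_pdivlMr ?addr_gt0//.
have h1 : a' * a * b' <= a' * a * (C * b) by rewrite ler_wpM2l// ltW// mulr_gt0.
have h2 : b' * b * a' <= b' * b * (C * a) by rewrite ler_wpM2l// ltW// mulr_gt0.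
nra.
Qed.

(** This is the Hoelder bound for exponent 0: since [kbar kappa x y] is [kappa x]
    times [2 * kappa y / (kappa x + kappa y)], and symmetrically, the two values
    contribute to the difference with factors that sum to 2. *)
Lemma wle_diff kappa f c : (forall z, 0 < kappa z) -> wle kappa f c ->
  forall x y, `|f x - f y| * kbar kappa x y <= 2 * c.
Proof.
move=> k0 fc x y; have a0 := k0 x; have b0 := k0 y.
have fx := fc x; have fy := fc y.
have tri : `|f x - f y| <= `|f x| + `|f y| by exact: ler_normB.
rewrite /kbar mulrA ler_pdivrMr ?addr_gt0//.
have -> : `|f x - f y| * (2 * kappa x * kappa y) = 2 * `|f x - f y| * kappa x * kappa y by ring.
have s1 : `|f x - f y| * kappa x * kappa y <= (`|f x| + `|f y|) * kappa x * kappa y.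
  by rewrite -!mulrA ler_wpM2r// ltW// mulr_gt0.
have s2 : `|f x| * kappa x * kappa y <= c * kappa y by rewrite ler_wpM2r// ltW.
have s3 : `|f y| * kappa y * kappa x <= c * kappa x by rewrite ler_wpM2r// ltW.
nra.
Qed.

Lemma hoelder_leP alpha kappa f c : (forall z, 0 < kappa z) ->
  (hoelder_norm alpha kappa f <= c%:E)%E <-> hle alpha kappa f c.
Proof.
move=> k0; rewrite /hoelder_norm ge_max; split=> [/andP[/wnorm_leP w H]|[w H]].
  split=> // x y; have [->|/eqP xy] := eqVneq x y.
    rewrite !subrr normr0 mul0r mulr_ge0 ?powR_ge0//.
    by apply: le_trans (w x); rewrite mulr_ge0// ltW.
  have p0 : 0 < enorm (x - y) `^ alpha.
    by rewrite powR_gt0// enorm_gt0// => /eqP; rewrite subr_eq0 => /eqP.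
  rewrite -ler_pdivrMr// mulrAC -lee_fin; apply: le_trans H.
  by apply: ereal_sup_ubound; exists (x, y).
apply/andP; split; first exact/wnorm_leP.
apply: ge_ereal_sup => _ [[x y] /= xy <-]; rewrite lee_fin.
have p0 : 0 < enorm (x - y) `^ alpha.
  by rewrite powR_gt0// enorm_gt0// => /eqP; rewrite subr_eq0 => /eqP.
by rewrite mulrAC ler_pdivrMr.
Qed.

Lemma wle_ge0 kappa f c : (forall z, 0 < kappa z) -> wle kappa f c -> 0 <= c.
Proof. by move=> k0 /(_ 0); apply: le_trans; rewrite mulr_ge0// ltW. Qed.

Lemma wle_le kappa f c c' : c <= c' -> wle kappa f c -> wle kappa f c'.
Proof. by move=> cc H x; exact: le_trans (H x) cc. Qed.

Lemma hle_le alpha kappa f c c' : c <= c' -> hle alpha kappa f c ->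
  hle alpha kappa f c'.
Proof.
move=> cc [H1 H2]; split; first exact: wle_le H1.
by move=> x y; apply: le_trans (H2 x y) _; rewrite ler_wpM2r// powR_ge0.
Qed.

Lemma hle_sub alpha kappa f g c c' : (forall z, 0 < kappa z) ->
  hle alpha kappa f c -> hle alpha kappa g c' ->
  hle alpha kappa (f \- g) (c + c').
Proof.
move=> k0 [f1 f2] [g1 g2]; split=> [x|x y] /=.
  apply: le_trans (lerD (f1 x) (g1 x)).
  by rewrite -mulrDl ler_wpM2r ?(ltW (k0 x))// ler_normB.
rewrite mulrDl; apply: le_trans (lerD (f2 x y) (g2 x y)).
rewrite -mulrDl ler_wpM2r ?(ltW (kbar_gt0 _ _ k0))//.
have -> : f x - g x - (f y - g y) = (f x - f y) - (g x - g y) by ring.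
exact: ler_normB.
Qed.

(** Where the weight is at least [m], a weighted Hoelder function is Hoelder. *)
Lemma hle_local alpha kappa f c m x y : 0 < m -> m <= kappa x -> m <= kappa y ->
  hle alpha kappa f c -> `|f x - f y| <= c / m * enorm (x - y) `^ alpha.
Proof.
move=> m0 mx my [_ /(_ x y)]; rewrite mulrAC ler_pdivlMr//; apply: le_trans.
by rewrite ler_wpM2l// kbar_ge_min.
Qed.

(** Continuity in terms of the norm, for functions of a row vector. *)
Lemma continuous_rowP (f : E -> R) : continuous f <->
  forall (x : E) (e : R), 0 < e -> \forall y \near x, `|f x - f y| <= e.
Proof.
split=> [fc x e e0|H x].
  by move/(@cvgrPdist_le _ _ _ (nbhs (x : E))) : (fc x); apply.
by apply/(@cvgrPdist_le _ _ _ (nbhs (x : E))) => e e0; exact: H.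
Qed.

(** The weight is bounded below near each point, so the weighted Hoelder bound is
    a local Hoelder bound there. *)
Lemma hle_continuous alpha kappa f c : 0 < alpha -> continuous kappa ->
  (forall z, 0 < kappa z) -> hle alpha kappa f c -> continuous f.
Proof.
move=> a0 kc k0 fc; have c0 : 0 <= c by case: fc => /(wle_ge0 k0).
apply/continuous_rowP => x e e0.
have m0 : 0 < kappa x / 2 by rewrite divr_gt0.
have [rho rho0 H] := powR_small a0 (divr_ge0 c0 (ltW m0)) e0.
have near_k := (continuous_rowP kappa).1 kc x _ m0.
have d1 : 0 < (d%:R : R) + 1 by rewrite ltr_wpDl.
have near_x : \forall y \near x, `|x - y| <= rho / (d%:R + 1).
  by apply: ((@cvgrPdist_le _ E _ (nbhs x) _ id x).1 cvg_id); exact: divr_gt0.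
near=> y.
have ky : kappa x / 2 <= kappa y.
  have : `|kappa x - kappa y| <= kappa x / 2 by near: y.
  rewrite ler_norml => /andP[_]; lra.
apply: le_trans (hle_local m0 _ ky fc) _.
  have := k0 x; lra.
apply: H; rewrite enorm_ge0/=; apply: le_trans (enorm_le_normr _) _.
have : `|x - y| <= rho / (d%:R + 1).
  by near: y; exact: near_x.
rewrite ler_pdivlMr//; have := normr_ge0 (x - y); lra.
Unshelve. all: by end_near. Qed.

(** Splitting the difference quotients at distance [rho] compares the
    [alpha']-norm with the weighted supremum norm and the [alpha]-norm. *)
Lemma hle_split (alpha alpha' : R) kappa g (c eps rho : R) :
  (forall z, 0 < kappa z) -> 0 < rho -> 0 <= alpha' < alpha ->
  wle kappa g eps -> hle alpha kappa g c ->
  hle alpha' kappa g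
    (Num.max eps (Num.max (2 * eps / rho `^ alpha') (c * rho `^ (alpha - alpha')))).
Proof.
move=> k0 rho0 /andP[a0 aa] ge gc; split=> [x|x y]; first by rewrite le_max ge.
have c0 : 0 <= c by case: gc => /(wle_ge0 k0).
have e0 := wle_ge0 k0 ge.
have p0 : 0 <= enorm (x - y) `^ alpha' by exact: powR_ge0.
have [xy|xy] := leP rho (enorm (x - y)).
  apply: (@le_trans _ _ (2 * eps / rho `^ alpha' * enorm (x - y) `^ alpha')); last first.
    by apply: ler_wpM2r => //; rewrite !le_max lexx/= orbT.
  apply: le_trans (wle_diff k0 ge x y) _.
  rewrite -mulrA ler_peMr ?mulr_ge0// mulrC ler_pdivlMr ?powR_gt0// mul1r.
  by apply: ge0_ler_powR; rewrite ?nnegrE ?enorm_ge0// ltW.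
apply: (@le_trans _ _ (c * rho `^ (alpha - alpha') * enorm (x - y) `^ alpha')); last first.
  by apply: ler_wpM2r => //; rewrite !le_max lexx !orbT.
apply: le_trans (gc.2 x y) _; rewrite -mulrA ler_wpM2l//.
have [->|n0] := eqVneq (enorm (x - y)) 0.
  rewrite powR0; first by rewrite mulr_ge0// powR_ge0.
  by rewrite gt_eqF// (le_lt_trans a0).
rewrite -{1}(subrK alpha' alpha) (@powRD _ (enorm (x - y))) ?n0 ?implybT//.
rewrite ler_wpM2r// ge0_ler_powR ?nnegrE ?enorm_ge0 ?(ltW rho0) ?(ltW xy)//.
by rewrite subr_ge0 ltW.
Qed.

(** Comparison of the norms for two weights. *)
Lemma hle_weight alpha kappa kappa' f c C : 0 < C ->
  (forall z, 0 < kappa z) -> (forall z, 0 < kappa' z) ->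
  (forall z, kappa' z <= C * kappa z) ->
  hle alpha kappa f c -> hle alpha kappa' f (C * c).
Proof.
move=> C0 k0 k0' kk [f1 f2]; split=> [x|x y].
  apply: (@le_trans _ _ (C * (`|f x| * kappa x))); last by rewrite ler_wpM2l// ltW.
  by rewrite [leRHS]mulrCA ler_wpM2l.
apply: (@le_trans _ _ (C * (`|f x - f y| * kbar kappa x y))).
  by rewrite [leRHS]mulrCA ler_wpM2l// kbar_scale_le.
by rewrite -mulrA ler_wpM2l// ltW.
Qed.

(** Choosing first the radius and then the uniform error small in
    [hle_split]: smallness in the weighted supremum norm gives smallness in the
    [alpha']-norm on bounded sets of the [alpha]-norm. *)
Lemma hle_interpolation (alpha alpha' : R) (c e : R) :
  0 <= alpha' < alpha -> 0 <= c -> 0 < e ->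
  exists2 eps : R, 0 < eps & forall kappa g, (forall z, 0 < kappa z) ->
    wle kappa g eps -> hle alpha kappa g c -> hle alpha' kappa g e.
Proof.
move=> aa c0 e0; have /andP[a0 ab] := aa.
have ab' : 0 < alpha - alpha' by rewrite subr_gt0.
have [rho rho0 H] := powR_small ab' c0 e0.
have p0 : 0 < rho `^ alpha' by rewrite powR_gt0.
exists (Num.min e (e * rho `^ alpha' / 2)).
  by rewrite lt_min e0/= divr_gt0// mulr_gt0.
move=> kappa g k0 ge gc.
apply: hle_le (hle_split k0 rho0 aa ge gc).
rewrite !ge_max ge_min lexx/= H ?lexx ?(ltW rho0)// andbT.
rewrite ler_pdivrMr// -ler_pdivlMl//.
by rewrite ge_min orbC (mulrC 2^-1) lexx.
Qed.

End WeightedNorms.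

(** * Membership in the weighted spaces *)

Section WeightedSpaces.
Context {R : realType} {d : nat}.
Local Notation E := 'rV[R]_d.
Variables (kappa : E -> R).
Hypothesis kappa_gt0 : forall x, 0 < kappa x.
Implicit Types (f g : E -> R).

Lemma Ck_wleP f : Ck kappa f <-> continuous f /\ exists c, wle kappa f c.
Proof.
split=> [[fc fw]|[fc [c fw]]]; split=> //.
  have fin : wnorm kappa f \is a fin_num.
    rewrite fin_numE (lt_eqF fw) andbT; apply/eqP => E0.
    have : ((`|f 0| * kappa 0)%:E <= wnorm kappa f)%E.
      by apply: ereal_sup_ubound; exists 0.
    by rewrite E0.
  by exists (fine (wnorm kappa f)); apply/wnorm_leP; rewrite fineK.
by move/wnorm_leP : fw => /le_lt_trans; apply; rewrite ltry.
Qed.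

Lemma ball_CkP f r : ball_Ck kappa r f <-> continuous f /\ wle kappa f r.
Proof.
split=> [[[fc _] /wnorm_leP]//|[fc fr]]; split; last exact/wnorm_leP.
by apply/Ck_wleP; split=> //; exists r.
Qed.

Lemma Calpha_hleP alpha f : 0 < alpha ->
  Calpha alpha kappa f <-> exists c, hle alpha kappa f c.
Proof.
move=> a0; split=> [[_ fw]|[c fc]].
  have fin : hoelder_norm alpha kappa f \is a fin_num.
    rewrite fin_numE (lt_eqF fw) andbT; apply/eqP => E0.
    have : ((`|f 0| * kappa 0)%:E <= hoelder_norm alpha kappa f)%E.
      by rewrite le_max; apply/orP; left; apply: ereal_sup_ubound; exists 0.
    by rewrite E0.
  by exists (fine (hoelder_norm alpha kappa f)); apply/hoelder_leP; rewrite ?fineK.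
split; first by move=> aE; rewrite aE ltxx in a0.
by move/(hoelder_leP _ _ _ kappa_gt0) : fc => /le_lt_trans; apply; rewrite ltry.
Qed.

Lemma ball_CalphaP alpha f r : 0 < alpha ->
  ball_Calpha alpha kappa r f <-> hle alpha kappa f r.
Proof.
move=> a0; split=> [[_ /hoelder_leP]|fr]; first exact.
split; last exact/hoelder_leP.
by apply/Calpha_hleP => //; exists r.
Qed.

Lemma supnorm_leP (K : set E) f c : 0 <= c ->
  (supnorm K f <= c%:E)%E <-> forall x, K x -> `|f x| <= c.
Proof.
move=> c0; rewrite /supnorm ge_max lee_fin c0/=; split=> [H x Kx|H].
  rewrite -lee_fin; apply: le_trans H; apply: ereal_sup_ubound.
  by exists x.
by apply: ge_ereal_sup => _ [x Kx <-]; rewrite lee_fin H.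
Qed.

End WeightedSpaces.

(** * Suprema of penalised linear operators *)

Section Envelopes.
Context {R : realType} {d : nat} {Lambda : Type}.
Local Notation E := 'rV[R]_d.
Variables (kappa : E -> R) (I : nat -> Lambda -> (E -> R) -> (E -> R))
  (etan : nat -> Lambda -> \bar R) (h : nat -> R)
  (lambda0 : nat -> Lambda) (omega alpha : R).
Hypothesis kappa_cont : continuous kappa.
Hypothesis kappa_gt0 : forall x, 0 < kappa x.
Hypothesis etan_ge0 : forall n l, (0 <= etan n l)%E.
Hypothesis h_gt0 : forall n, 0 < h n.
Hypothesis alpha_gt0 : 0 < alpha.
Hypothesis env : envelope_common kappa I etan h lambda0 omega.
Hypothesis stability : hoelder_stable kappa I h omega alpha.
Implicit Types (f g : E -> R).

(** The value at [x] of the operator with parameter [l], minus its penalty. The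
    real value [fine (etan n l)] is the penalty when the latter is finite. *)
Definition penalised n l f x := I n l f x - fine (etan n l) * h n.

(** [U] acts on the weighted space as the pointwise supremum of the penalised
    operators with parameter in [L]. Both the one-step operator, with the
    parameters of finite penalty, and the approximating networks, with finitely
    many parameters, are of this form, so they share all the estimates below. *)
Definition is_envelope n (L : set Lambda) (U : (E -> R) -> (E -> R)) :=
  forall f x, Ck kappa f ->
    (forall l, L l -> penalised n l f x <= U f x) /\
    (forall u, (forall l, L l -> penalised n l f x <= u) -> U f x <= u).

Let q n := expR (omega * h n).

Lemma growth_ge1 n : 1 <= q n.
Proof. by rewrite -expR0 ler_expR mulr_ge0 ?(env_omega env)// ltW. Qed.

Lemma operator_wle n l f c : Ck kappa f -> wle kappa f c ->
  wle kappa (I n l f) (q n * c).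
Proof.
move=> fC /wnorm_leP fc; apply/wnorm_leP.
apply: le_trans (env_growth env n l fC) _.
by rewrite EFinM lee_wpmul2l// lee_fin expR_ge0.
Qed.

Lemma operator_sub_wle n l f g c : Ck kappa f -> Ck kappa g ->
  wle kappa (f \- g) c -> wle kappa (I n l f \- I n l g) (q n * c).
Proof.
move=> fC gC fgc x.
have fgE : (fun y => -1 * g y + f y) = f \- g.
  by apply/funext => y /=; ring.
have fgC : Ck kappa (f \- g).
  apply/Ck_wleP; split; last by exists c.
  have [fk _] := fC; have [gk _] := gC.
  by move=> y; exact: (cvgB (fk y) (gk y)).
have := operator_wle n l fgC fgc x.
by rewrite -fgE (env_linear env)//= (_ : -1 * _ + _ = I n l f x - I n l g x)//; ring.
Qed.

Lemma operator_hle n l f c : hle alpha kappa f c ->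
  hle alpha kappa (I n l f) (q n * c).
Proof.
move=> fc; apply/(hoelder_leP _ _ _ kappa_gt0).
have fC : Calpha alpha kappa f by apply/Calpha_hleP => //; exists c.
have := stability n l fC; move=> /le_trans; apply.
rewrite EFinM lee_wpmul2l ?lee_fin ?expR_ge0//.
exact/hoelder_leP.
Qed.

Lemma hle_Ck f c : hle alpha kappa f c -> Ck kappa f.
Proof.
move=> fc; apply/Ck_wleP; split.
  exact: hle_continuous fc.
by exists c; case: fc.
Qed.

Section OneEnvelope.
Variables (n : nat) (L : set Lambda) (U : (E -> R) -> (E -> R)).
Hypothesis L0 : L (lambda0 n).
Hypothesis UL : is_envelope n L U.

(** A supremum of a family moves at most as much as its members do. *)
Lemma envelope_dist f g x y b : Ck kappa f -> Ck kappa g ->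
  (forall l, L l -> `|I n l f x - I n l g y| <= b) -> `|U f x - U g y| <= b.
Proof.
move=> fC gC H.
have [f1 f2] := UL x fC; have [g1 g2] := UL y gC.
have gf : U g y <= U f x + b.
  apply: g2 => l Ll; have := f1 _ Ll; have := H _ Ll.
  rewrite /penalised ler_norml; lra.
have fg : U f x <= U g y + b.
  apply: f2 => l Ll; have := g1 _ Ll; have := H _ Ll.
  rewrite /penalised ler_norml; lra.
rewrite ler_norml; apply/andP; split; lra.
Qed.

(** The upper bound uses that penalties are nonnegative, the lower one that
    [lambda0 n] has penalty 0. *)
Lemma envelope_wle f c : Ck kappa f -> wle kappa f c ->
  wle kappa (U f) (q n * c).
Proof.
move=> fC fc x; rewrite -ler_pdivlMr//.
have [f1 f2] := UL x fC.
have Ib l : `|I n l f x| <= q n * c / kappa x.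
  by rewrite ler_pdivlMr//; exact: operator_wle.
rewrite ler_norml; apply/andP; split.
  apply: le_trans (f1 _ L0); rewrite /penalised (env_zero env)/= mul0r subr0.
  by have := Ib (lambda0 n); rewrite ler_norml => /andP[].
apply: f2 => l Ll; have := Ib l; rewrite ler_norml => /andP[_].
apply: le_trans; rewrite /penalised gerBl mulr_ge0 ?fine_ge0//.
exact: ltW.
Qed.

Lemma envelope_hle f c : hle alpha kappa f c -> hle alpha kappa (U f) (q n * c).
Proof.
move=> fc; split; first exact: envelope_wle (hle_Ck fc) fc.1.
move=> x y; rewrite -ler_pdivlMr ?kbar_gt0//.
apply: envelope_dist => //; try exact: hle_Ck fc.
by move=> l Ll; rewrite ler_pdivlMr ?kbar_gt0//; exact: (operator_hle n l fc).2.
Qed.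

Lemma envelope_sub_wle f g c : Ck kappa f -> Ck kappa g ->
  wle kappa (f \- g) c -> wle kappa (U f \- U g) (q n * c).
Proof.
move=> fC gC fgc x /=; rewrite -ler_pdivlMr//.
apply: envelope_dist => // l Ll; rewrite ler_pdivlMr//.
exact: operator_sub_wle fgc x.
Qed.

Lemma envelope_iter_hle f c k : hle alpha kappa f c ->
  hle alpha kappa (iter k U f) (q n ^+ k * c).
Proof.
move=> fc; elim: k => [|k IH] /=; first by rewrite expr0 mul1r.
by rewrite exprS -mulrA; exact: envelope_hle.
Qed.

Lemma envelope_iter_sub_wle f g c b b' k :
  hle alpha kappa f b -> hle alpha kappa g b' -> wle kappa (f \- g) c ->
  wle kappa (iter k U f \- iter k U g) (q n ^+ k * c).
Proof.
move=> fb gb fgc; elim: k => [|k IH] /=; first by rewrite expr0 mul1r.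
rewrite exprS -mulrA; apply: envelope_sub_wle IH.
- exact: hle_Ck (envelope_iter_hle k fb).
- exact: hle_Ck (envelope_iter_hle k gb).
Qed.

(** If one step moves [f] by at most [c] in the weighted supremum norm, then [j]
    further steps move any iterate by at most [j * c], up to the growth factor. *)
Lemma envelope_iter_step_wle f b c k j : hle alpha kappa f b ->
  0 <= c -> wle kappa (U f \- f) c ->
  wle kappa (iter (k + j) U f \- iter k U f) (q n ^+ (k + j) * (j%:R * c)).
Proof.
move=> fb c0 Ufc; elim: j => [|j IH] x /=.
  by rewrite addn0 subrr normr0 !mul0r mulr0.
rewrite addnS.
have := envelope_iter_sub_wle (k + j) (envelope_hle fb) fb Ufc x.
rewrite /= -iterSr; have := IH x; rewrite /= => H1 H2.
have := ler_distD (iter (k + j) U f x) (iter (k + j).+1 U f x) (iter k U f x).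
move=> /(ler_wpM2r (ltW (kappa_gt0 x))); rewrite mulrDl => /le_trans; apply.
apply: le_trans (lerD H2 H1) _.
have q1 : q n ^+ (k + j) <= q n ^+ (k + j).+1 by rewrite ler_weXn2l// growth_ge1.
rewrite -mulrDr -[c in c + _]mul1r -mulrDl nat1r ler_wpM2r// mulr_ge0//.
Qed.

End OneEnvelope.

(** Parameters of infinite penalty contribute [-oo] to a supremum that is finite,
    so they can be ignored. *)
Section Suprema.
Variables (n : nat) (L : set Lambda) (f : E -> R) (x : E).
Hypothesis sup_fin : env_sup I etan h L n f x \is a fin_num.

Lemma env_sup_ub l : L l -> (etan n l < +oo)%E ->
  penalised n l f x <= fine (env_sup I etan h L n f x).
Proof.
move=> Ll le; rewrite -lee_fin fineK//; apply: ereal_sup_ubound.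
exists l => //; have fe : etan n l \is a fin_num by rewrite ge0_fin_numE.
by rewrite /penalised -{1}(fineK fe) -EFinM -EFinB.
Qed.

Lemma env_sup_lub u :
  (forall l, L l -> (etan n l < +oo)%E -> penalised n l f x <= u) ->
  fine (env_sup I etan h L n f x) <= u.
Proof.
move=> H; rewrite -lee_fin fineK//; apply: ge_ereal_sup => _ [l Ll <-].
have [fe|] := boolP (etan n l \is a fin_num).
  rewrite -{1}(fineK fe) -EFinM -EFinB lee_fin; apply: H => //.
  by rewrite -ge0_fin_numE.
rewrite ge0_fin_numE// -leNgt leye_eq => /eqP ->.
by rewrite gt0_mulye ?lte_fin//= leNye.
Qed.

End Suprema.

Lemma env_sup_setT_fin n f x : Ck kappa f ->
  env_sup I etan h setT n f x \is a fin_num.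
Proof.
move=> fC; have [_ [c fc]] := (Ck_wleP kappa f).1 fC.
rewrite fin_numElt; apply/andP; split.
  apply: (@lt_le_trans _ _ (I n (lambda0 n) f x)%:E); first by rewrite ltNyr.
  apply: ereal_sup_ubound; exists (lambda0 n) => //.
  by rewrite (env_zero env) mul0e sube0.
apply: (@le_lt_trans _ _ (q n * c / kappa x)%:E); last by rewrite ltry.
apply: ge_ereal_sup => _ [l _ <-].
apply: (@le_trans _ _ (I n l f x)%:E).
  by rewrite geeDl// oppe_le0 mule_ge0// lee_fin ltW.
rewrite lee_fin ler_pdivlMr//.
apply: le_trans (operator_wle n l fC fc x).
by rewrite ler_wpM2r ?(ltW (kappa_gt0 x))// ler_norm.
Qed.

Lemma Iop_is_envelope n :
  is_envelope n [set l | (etan n l < +oo)%E] (Iop I etan h n).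
Proof.
move=> f x fC; have fin := env_sup_setT_fin n x fC; split=> [l|u H].
  exact: env_sup_ub.
by apply: env_sup_lub => // l _; exact: H.
Qed.

End Envelopes.

(** * Maxima as ReLU networks *)

Section ReluMaximum.
Context {R : realType}.

Local Notation relu_mx := (map_mx (fun s : R => Num.max s 0)).

Lemma maxr0_relu (s : R) : Num.max s 0 - Num.max (- s) 0 = s.
Proof. by case: (leP s 0); case: (leP (- s) 0); lra. Qed.

Lemma maxr_relu (s t : R) :
  Num.max s t = t + Num.max (s - t) 0.
Proof. by case: (leP s t); case: (leP (s - t) 0); lra. Qed.

Lemma relu_network_layer m k p (A : 'M[R]_(m, k)) (B : 'M[R]_(k, p)) :
  relu_network (fun x => relu_mx (x *m A) *m B).
Proof.
have nA := relu_affine A 0; have nB := relu_affine B 0.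
have := relu_comp (relu_comp nA (relu_activation k)) nB.
rewrite (_ : _ \o _ = fun x => relu_mx (x *m A) *m B)//.
by apply/funext => x /=; rewrite !addr0.
Qed.

(** One layer replaces the first two coordinates by their maximum and passes the
    other ones through, each value [s] being written as
    [max s 0 - max (- s) 0]. *)
Lemma relu_network_merge m : exists phi : 'rV[R]_m.+2 -> 'rV[R]_m.+1,
  [/\ relu_network phi,
      forall x, phi x 0 ord0 = Num.max (x 0 ord0) (x 0 (lift ord0 ord0)) &
      forall x j, phi x 0 (lift ord0 j) = x 0 (lift ord0 (lift ord0 j))].
Proof.
pose P : 'M[R]_(m.+2, m.+1) := \matrix_(i, j) (i == lift ord0 j)%:R.
pose D : 'M[R]_(m.+2, 1) := \col_i ((i == ord0)%:R - (i == lift ord0 ord0)%:R).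
pose A := row_mx P (row_mx (- P) D).
pose B := col_mx (1%:M : 'M[R]_m.+1) (col_mx (- 1%:M) (delta_mx 0 ord0 : 'M[R]_(1, m.+1))).
have xP (x : 'rV[R]_m.+2) j : (x *m P) 0 j = x 0 (lift ord0 j).
  rewrite mxE (bigD1 (lift ord0 j))//= mxE eqxx mulr1 big1 ?addr0// => i ij.
  by rewrite mxE (negbTE ij) mulr0.
have xD (x : 'rV[R]_m.+2) : (x *m D) 0 0 = x 0 ord0 - x 0 (lift ord0 ord0).
  rewrite mxE (eq_bigr (fun i => x 0 i * (i == ord0)%:R - x 0 i * (i == lift ord0 ord0)%:R)); last first.
    by move=> i _; rewrite mxE mulrBr.
  rewrite sumrB; congr (_ - _).
    by rewrite (bigD1 ord0)//= mulr1 big1 ?addr0// => i /negbTE ->; rewrite mulr0.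
  by rewrite (bigD1 (lift ord0 ord0))//= mulr1 big1 ?addr0// => i /negbTE ->; rewrite mulr0.
exists (fun x => relu_mx (x *m A) *m B).
have E (x : 'rV[R]_m.+2) j : (relu_mx (x *m A) *m B) 0 j = x 0 (lift ord0 j) +
    (j == ord0)%:R * Num.max (x 0 ord0 - x 0 (lift ord0 ord0)) 0.
  rewrite /A /B !mul_mx_row !map_row_mx !mul_row_col mulmx1 mulmxN mulmxN mulmx1.
  move: (xP x j) (xD x); move: (x *m P) (x *m D) => u w <- <-.
  by rewrite !mxE big_ord1 !mxE eqxx/= addrA maxr0_relu mulrC.
by split=> [|x|x j]; [exact: relu_network_layer|rewrite E maxr_relu mul1r|rewrite E mul0r addr0].
Qed.

(** The maximum of finitely many coordinates is a ReLU network. *)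
Lemma relu_network_max m : exists phi : 'rV[R]_m.+1 -> 'rV[R]_1,
  [/\ relu_network phi, forall (x : 'rV_m.+1) j, x 0 j <= phi x 0 0 &
      forall x : 'rV_m.+1, exists j, phi x 0 0 = x 0 j].
Proof.
elim: m => [|m [phi [nphi ub at_]]].
  exists (fun x => x *m 1%:M + 0); split; first exact: relu_affine.
    by move=> x j; rewrite mulmx1 addr0 (ord1 j).
  by move=> x; exists 0; rewrite mulmx1 addr0.
have [psi [npsi psi0 psiS]] := relu_network_merge m.
exists (phi \o psi); split; first exact: relu_comp.
- move=> x j /=.
  have p0 : Num.max (x 0 ord0) (x 0 (lift ord0 ord0)) <= phi (psi x) 0 0.
    by rewrite -psi0; exact: ub.
  move: p0; rewrite ge_max => /andP[p0 p1].
  have [j' ->|->//] := unliftP ord0 j.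
  have [j'' ->|->//] := unliftP ord0 j'.
  by rewrite -psiS; exact: ub.
- move=> x /=; have [j ->] := at_ (psi x).
  have [j' ->|->] := unliftP ord0 j; first by exists (lift ord0 (lift ord0 j')).
  by rewrite psi0; case: leP => _; [exists (lift ord0 ord0)|exists ord0].
Qed.

Lemma relu_network_max_affine m (b : 'rV[R]_m.+1) :
  exists phi : 'rV[R]_m.+1 -> 'rV[R]_1,
  [/\ relu_network phi, forall (x : 'rV_m.+1) j, x 0 j + b 0 j <= phi x 0 0 &
      forall x : 'rV_m.+1, exists j, phi x 0 0 = x 0 j + b 0 j].
Proof.
have [phi [nphi ub at_]] := relu_network_max m.
exists (phi \o (fun x => x *m 1%:M + b)); split.
- exact: relu_comp (relu_affine _ _) nphi.
- by move=> x j /=; have := ub (x *m 1%:M + b) j; rewrite mulmx1 mxE.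
- by move=> x /=; have [j ->] := at_ (x *m 1%:M + b); exists j; rewrite mulmx1 mxE.
Qed.

End ReluMaximum.

(** * Approximation of the envelope iterates at a fixed step size *)

Section NeuralEnvelopes.
Context {R : realType} {d : nat} {Lambda : Type}.
Local Notation E := 'rV[R]_d.
Variables (kappa : E -> R) (I : nat -> Lambda -> (E -> R) -> (E -> R))
  (etan : nat -> Lambda -> \bar R) (h : nat -> R)
  (lambda0 : nat -> Lambda) (omega alpha : R).
Hypothesis kappa_cont : continuous kappa.
Hypothesis kappa_gt0 : forall x, 0 < kappa x.
Hypothesis I_Ck : forall n l, maps_Ck kappa (I n l).
Hypothesis etan_ge0 : forall n l, (0 <= etan n l)%E.
Hypothesis h_gt0 : forall n, 0 < h n.
Hypothesis alpha_gt0 : 0 < alpha.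
Hypothesis env : envelope_common kappa I etan h lambda0 omega.
Hypothesis stability : hoelder_stable kappa I h omega alpha.
Hypothesis compactness : parameter_compact kappa I etan h lambda0 alpha.
Implicit Types (f g : E -> R).

(** The envelope over finitely many parameters is an envelope-neural operator. *)
Lemma finite_envelope_neural n M (lam : 'I_M -> Lambda) : (0 < M)%N ->
  exists2 Phi, envelope_neural kappa I lambda0 n Phi &
    is_envelope kappa I etan h n
      [set l | l = lambda0 n \/ exists j, l = lam j] Phi.
Proof.
move=> M0.
pose par (j : 'I_M.+1) := if unlift ord0 j is Some j' then lam j' else lambda0 n.
have parP l : (l = lambda0 n \/ exists j, l = lam j) <-> exists j, l = par j.
  split=> [[->|[j ->]]|[j ->]].
  - by exists ord0; rewrite /par unlift_none.
  - by exists (lift ord0 j); rewrite /par liftK.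
  - by rewrite /par; case: (unlift ord0 j) => [j'|]; [right; exists j'|left].
have [phi [nphi ub at_]] := relu_network_max_affine
  (\row_j (- (fine (etan n (par j)) * h n))).
pose Phi f x := phi (\row_j I n (par j) f x) 0 0.
have PhiE : is_envelope kappa I etan h n
    [set l | l = lambda0 n \/ exists j, l = lam j] Phi.
  move=> f x fC; split.
    move=> l /parP[j ->]; have := ub (\row_j I n (par j) f x) j.
    by rewrite !mxE.
  move=> u H; have [j] := at_ (\row_j I n (par j) f x).
  by rewrite /Phi => ->; rewrite !mxE; apply: H; apply/parP; exists j.
exists Phi => //; split; last by exists M, lam, phi.
move=> f fC; apply/Ck_wleP; split; last first.
  have [_ [c fc]] := (Ck_wleP kappa f).1 fC.
  exists (expR (omega * h n) * c).
  by apply: (envelope_wle kappa_gt0 etan_ge0 h_gt0 env _ PhiE) => //; left.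
apply/continuous_rowP => x e e0.
have near_Phi : forall y, (forall j, `|I n (par j) f x - I n (par j) f y| <= e) ->
    `|Phi f x - Phi f y| <= e.
  move=> y H; apply: (envelope_dist PhiE) => // l /parP[j ->]; exact: H.
apply: (filterS near_Phi).
apply: (@filter_forall E 'I_M.+1 (fun j y => `|I n (par j) f x - I n (par j) f y| <= e) _ (nbhs_filter x)) => j.
have [Ic _] := @I_Ck n (par j) f fC.
exact: (continuous_rowP _).1 Ic x e e0.
Qed.

(** A finite net of the parameter space gives an envelope-neural operator that
    approximates the one-step operator uniformly on a Hoelder ball. *)
Lemma one_step_approx n (r eps : R) : 0 <= r -> 0 < eps ->
  exists Phi, [/\ envelope_neural kappa I lambda0 n Phi,
    exists2 L : set Lambda, L (lambda0 n) & is_envelope kappa I etan h n L Phi &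
    forall f, hle alpha kappa f r -> wle kappa (Iop I etan h n f \- Phi f) eps].
Proof.
move=> r0 eps0; have [Lr [dist [[metr tb] supE H Lr0]]] := compactness r0.
have [delta delta0 {}H] := H _ eps0.
have [_ _ dsym dtri] := metr.
have [F [finF FL Fnet]] := tb _ (divr_gt0 delta0 (ltr0n _ 2)).
pose Lrn := Lr `&` [set l | (etan n l < +oo)%E].
have L0n : Lrn (lambda0 n).
  by split; [exact: Lr0|rewrite /= (env_zero env) ltry].
have /finite_seqP[s Fs] : finite_set (F : set {classic Lambda}) by [].
(* A point of the net need not have finite penalty: it is replaced by a nearby
   parameter of finite penalty whenever there is one. *)
have /choice[pick pickP] : forall y, exists l, Lrn l /\
    ((exists2 l', Lrn l' & dist l' y < delta / 2) -> dist l y < delta / 2).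
  move=> y; have [[l' Ll' yl']|no] := pselect (exists2 l', Lrn l' & dist l' y < delta / 2).
    by exists l'.
  by exists (lambda0 n); split.
pose net := lambda0 n :: map pick s.
have netL (j : 'I_(size net)) : Lrn (nth (lambda0 n) net j).
  case: j => -[|j]//=; rewrite size_map => js.
  by rewrite (nth_map (lambda0 n : {classic Lambda}))//; case: (pickP (nth (lambda0 n : {classic Lambda}) s j)).
have [Phi nPhi PhiE] := finite_envelope_neural n (M := size net)
  (fun j => nth (lambda0 n) net j) isT.
exists Phi; split=> //; first by eexists; last exact: PhiE; left.
move=> f fr x; have fC := hle_Ck kappa_cont kappa_gt0 alpha_gt0 fr.
have [ub lub] := PhiE f x fC.
have fin := env_sup_setT_fin kappa_gt0 etan_ge0 h_gt0 env n x fC.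
have fb : ball_Calpha alpha kappa r f by apply/ball_CalphaP.
rewrite -ler_pdivlMr//=.
have le1 : Phi f x <= Iop I etan h n f x.
  apply: lub => l Hl; apply: env_sup_ub => //.
  by case: Hl => [->|[j ->]]; [case: L0n|case: (netL j)].
have le2 : Iop I etan h n f x <= Phi f x + eps / kappa x.
  rewrite /Iop (supE n f x fb); apply: env_sup_lub => //; first by rewrite -supE.
  move=> l [Ll le] _; have [y Fy ly] := Fnet l Ll.
  have [Lp /(_ (ex_intro2 _ _ l (conj Ll le) ly)) py] := pickP y.
  have ys : (y : {classic Lambda}) \in s by move: Fy; rewrite Fs.
  have jn : ((index (y : {classic Lambda}) s).+1 < size net)%N.
    by rewrite /= size_map ltnS index_mem.
  have Py : penalised I etan h n (pick y) f x <= Phi f x.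
    apply: ub; right; exists (Ordinal jn) => /=.
    by rewrite (nth_map (lambda0 n : {classic Lambda})) ?index_mem// nth_index.
  have [Lpy _] := Lp.
  have Ly := FL _ Fy.
  have ld : dist l (pick y) < delta.
    apply: le_lt_trans (dtri l y (pick y) Ll Ly Lpy) _.
    by rewrite (dsym y)// [ltRHS]splitr ltrD.
  have /ltW/wnorm_leP/(_ x) := H n f _ _ fb (conj Ll le) Lp ld.
  rewrite -ler_pdivlMr// -/(penalised I etan h n l f x).
  rewrite -/(penalised I etan h n (pick y) f x) ler_norml; lra.
by rewrite ger0_norm ?subr_ge0// lerBlDl.
Qed.

Lemma growth_iter_le n (T t : R) k : 0 <= t <= T -> (k <= nsteps h n t)%N ->
  expR (omega * h n) ^+ k <= expR (omega * T).
Proof.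
move=> /andP[t0 tT]; rewrite nsteps_max// => kt.
rewrite -expRM_natl ler_expR mulrCA ler_wpM2l ?(env_omega env)//.
exact: le_trans kt tT.
Qed.

Lemma nsteps_le n (t T : R) : 0 <= t <= T -> (nsteps h n t <= nsteps h n T)%N.
Proof.
move=> /andP[t0 tT]; rewrite nsteps_max//; last exact: le_trans tT.
by apply: le_trans tT; rewrite -nsteps_max.
Qed.

(** The envelope iterates stay in a Hoelder ball whose radius depends on the
    horizon only. *)
Lemma iter_pi_hle n L U (f : E -> R) (r t T : R) :
  L (lambda0 n) -> is_envelope kappa I etan h n L U ->
  0 <= t <= T -> hle alpha kappa f r ->
  hle alpha kappa (iter_pi h U n t f) (expR (omega * T) * r).
Proof.
move=> L0 UL tT fr; have r0 := wle_ge0 kappa_gt0 fr.1.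
apply: hle_le (envelope_iter_hle kappa_cont kappa_gt0 etan_ge0 h_gt0 alpha_gt0
  env stability L0 UL _ fr).
by rewrite ler_wpM2r// (growth_iter_le tT (leqnn _)).
Qed.

(** A one-step error [eps] on a large enough Hoelder ball accumulates to at most
    [q ^+ k * (k * eps)] after [k] steps, where [q] is the growth factor of one
    step. *)
Lemma iter_error n (L : set Lambda) Phi (f : E -> R) (r t T eps : R) k :
  0 <= eps -> L (lambda0 n) -> is_envelope kappa I etan h n L Phi ->
  (forall g, hle alpha kappa g (expR (omega * T) * r) ->
     wle kappa (Iop I etan h n g \- Phi g) eps) ->
  0 <= t <= T -> hle alpha kappa f r -> (k <= nsteps h n t)%N ->
  wle kappa (iter k (Iop I etan h n) f \- iter k Phi f)
    (expR (omega * h n) ^+ k * (k%:R * eps)).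
Proof.
move=> eps0 L0 PhiL one tT fr; have r0 := wle_ge0 kappa_gt0 fr.1.
have IL := Iop_is_envelope kappa_gt0 etan_ge0 h_gt0 env n.
have IL0 : [set l | (etan n l < +oo)%E] (lambda0 n).
  by rewrite /= (env_zero env) ltry.
elim: k => [|k IH] kt x /=; first by rewrite subrr normr0 !mul0r mulr0.
set q := expR _.
have hI := envelope_iter_hle kappa_cont kappa_gt0 etan_ge0 h_gt0 alpha_gt0
  env stability IL0 IL k fr.
have hP := envelope_iter_hle kappa_cont kappa_gt0 etan_ge0 h_gt0 alpha_gt0
  env stability L0 PhiL k fr.
have CI := hle_Ck kappa_cont kappa_gt0 alpha_gt0 hI.
have CP := hle_Ck kappa_cont kappa_gt0 alpha_gt0 hP.
have H1 := envelope_sub_wle kappa_gt0 env IL CI CP (IH (ltnW kt)) x.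
have H2 : `|Iop I etan h n (iter k Phi f) x - Phi (iter k Phi f) x| * kappa x <= eps.
  apply: one; apply: hle_le hP.
  by rewrite ler_wpM2r// (growth_iter_le tT (ltnW kt)).
have := ler_distD (Iop I etan h n (iter k Phi f) x)
  (Iop I etan h n (iter k (Iop I etan h n) f) x) (Phi (iter k Phi f) x).
move=> /(ler_wpM2r (ltW (kappa_gt0 x))); rewrite mulrDl => /le_trans; apply.
apply: le_trans (lerD H1 H2) _; rewrite -/q mulrA -exprS.
have q1 : 1 <= q ^+ k.+1 by rewrite exprn_ege1// (growth_ge1 h_gt0 env n).
rewrite -[eps in _ + eps]mul1r -nat1r mulrDl mul1r [in leRHS]addrC mulrDr.
by rewrite lerD2l ler_peMl.
Qed.

(** The iterates of a finite envelope stay in the same Hoelder ball as those of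
    the one-step operator, so the accumulated error in the weighted supremum norm
    is improved to the [alpha']-norm by interpolation. *)
Lemma neural_approx n (r T alpha' e : R) : 0 <= r -> 0 <= T ->
  0 <= alpha' < alpha -> 0 < e ->
  exists2 Phi, envelope_neural kappa I lambda0 n Phi &
    forall f t, hle alpha kappa f r -> 0 <= t <= T ->
      hle alpha' kappa
        (iter_pi h (Iop I etan h n) n t f \- iter_pi h Phi n t f) e.
Proof.
move=> r0 T0 aa e0; set Q := expR (omega * T).
have Q0 : 0 < Q by exact: expR_gt0.
have Qr0 : 0 <= Q * r by rewrite mulr_ge0// ltW.
have [eps eps0 Heps] := @hle_interpolation R d _ _ _ _ aa (addr_ge0 Qr0 Qr0) e0.
pose K := nsteps h n T.
have K0 : 0 < Q * K.+1%:R by rewrite mulr_gt0.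
have [Phi [nPhi [L L0 PhiL] one]] := one_step_approx n Qr0 (divr_gt0 eps0 K0).
exists Phi => // f t fr tT.
have IL := Iop_is_envelope kappa_gt0 etan_ge0 h_gt0 env n.
have IL0 : [set l | (etan n l < +oo)%E] (lambda0 n).
  by rewrite /= (env_zero env) ltry.
apply: (Heps) => //; last first.
  by apply: hle_sub => //; [exact: iter_pi_hle IL0 IL tT fr|exact: iter_pi_hle L0 PhiL tT fr].
apply: wle_le (iter_error (ltW (divr_gt0 eps0 K0)) L0 PhiL one tT fr (leqnn _)).
rewrite mulrA [_ * (eps / _)]mulrCA ler_piMr ?(ltW eps0)//.
rewrite ler_pdivrMr// mul1r ler_pM ?exprn_ge0 ?expR_ge0//.
  exact: growth_iter_le tT (leqnn _).
by rewrite ler_nat leqW// nsteps_le.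
Qed.

End NeuralEnvelopes.

(** * The logistic function and the algebra it generates *)

Section Logistic.
Context {R : realType}.

(** The logistic function; its derivative is a polynomial in itself. *)
Definition logistic (x : R) : R := (1 + expR (- x))^-1.

Lemma logistic_den_gt0 (x : R) : 0 < 1 + expR (- x).
Proof. by rewrite addr_gt0// expR_gt0. Qed.

Lemma logistic_gt0 (x : R) : 0 < logistic x.
Proof. by rewrite invr_gt0 logistic_den_gt0. Qed.

Lemma logistic_lt1 (x : R) : logistic x < 1.
Proof. by rewrite invf_lt1 ?logistic_den_gt0// ltrDl expR_gt0. Qed.

Lemma is_derive_logistic (x : R) :
  is_derive x 1 logistic (logistic x * (1 - logistic x)).
Proof.
have d0 : 1 + expR (- x) != 0 by rewrite gt_eqF// logistic_den_gt0.
have dD : is_derive x 1 (fun y => 1 + expR (- y)) (- expR (- x)).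
  have dN : is_derive x 1 (fun y : R => - y) (- 1) by exact: is_deriveN.
  have dE := is_deriveD (is_derive_cst (1 : R) x 1)
    (is_derive1_comp (is_derive_expR (- x)) dN).
  by apply: (is_derive_eq dE); rewrite add0r mulrN1.
have dV := @is_deriveV R (fun y => 1 + expR (- y)) x _ 1 d0 dD.
have -> : logistic x * (1 - logistic x) = - (1 + expR (- x)) ^- 2 *: (- expR (- x)).
  by rewrite /logistic /GRing.scale/=; field.
exact: dV.
Qed.

Lemma logistic_diff (a b : R) :
  logistic b - logistic a =
  (expR (- a) - expR (- b)) / ((1 + expR (- a)) * (1 + expR (- b))).
Proof.
rewrite /logistic; field.
by rewrite !gt_eqF ?logistic_den_gt0.
Qed.

Lemma logistic_le (a b : R) : a <= b -> logistic a <= logistic b.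
Proof.
move=> ab; rewrite -subr_ge0 logistic_diff divr_ge0//.
by rewrite subr_ge0 ler_expR lerN2.
Qed.

Lemma logistic_lip (a b : R) : `|logistic a - logistic b| <= `|a - b|.
Proof.
wlog ab : a b / a <= b.
  by move=> H; case: (leP a b) => [/H//|/ltW/H]; rewrite distrC (distrC b).
rewrite !(distrC a) !(distrC _ (logistic b)) !ger0_norm ?subr_ge0 ?logistic_le//.
rewrite logistic_diff ler_pdivrMr ?mulr_gt0 ?logistic_den_gt0//.
have ua := expR_gt0 (- a); have ub := expR_gt0 (- b).
have bE : expR (- b) = expR (- a) * expR (a - b).
  by rewrite -expRD; congr expR; ring.
have /(ler_wpM2l (ltW ua)) := expR_ge1Dx (a - b); rewrite -bE => h.
apply: (@le_trans _ _ ((b - a) * expR (- a))); first lra.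
rewrite ler_wpM2l ?subr_ge0//; nra.
Qed.

(** The inverse of the logistic function is continuous, uniformly near points of
    a bounded interval. *)
Lemma logistic_separation (M tau : R) : 0 < tau -> exists2 rho : R, 0 < rho &
  forall a b, `|a| <= M -> `|logistic a - logistic b| <= rho -> `|a - b| <= tau.
Proof.
move=> tau0; pose M' := M + tau.
have k0 : 0 < (1 + expR M') ^+ 2 by rewrite exprn_gt0// addr_gt0// expR_gt0.
pose c := expR (- M') * tau / (1 + expR M') ^+ 2.
have c0 : 0 < c by rewrite divr_gt0// mulr_gt0// expR_gt0.
(* Increments over a step [tau] inside the interval of radius [M'] are at least
   [c]. *)
have gap a : - M' <= a -> a + tau <= M' -> c <= logistic (a + tau) - logistic a.
  move=> aM bM; rewrite logistic_diff /c.
  have v0 := expR_gt0 (- (a + tau)).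
  have aE : expR (- a) = expR (- (a + tau)) * expR tau.
    by rewrite -expRD; congr expR; ring.
  have h1 : expR (- M') <= expR (- (a + tau)) by rewrite ler_expR lerN2.
  have h2 := expR_ge1Dx tau.
  have num : expR (- M') * tau <= expR (- a) - expR (- (a + tau)).
    apply: (@le_trans _ _ (expR (- (a + tau)) * tau)); first by rewrite ler_wpM2r// ltW.
    rewrite aE -[X in _ <= _ - X]mulr1 -mulrBr ler_wpM2l//; lra.
  apply: ler_pM => //.
  - by rewrite mulr_ge0 ?expR_ge0// ltW.
  - rewrite lef_pV2 ?posrE// ?mulr_gt0 ?logistic_den_gt0//.
    by rewrite expr2 ler_pM ?(ltW (logistic_den_gt0 _))// lerD2l ler_expR; lra.
exists (c / 2); first by rewrite divr_gt0.
move=> a b; rewrite ler_norml => /andP[a1 a2]; apply: contraTT; rewrite -!ltNge => ab.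
apply: (@lt_le_trans _ _ c); first by lra.
move: ab; rewrite ltr_normr => /orP[ab|ab].
  have g : c <= logistic a - logistic (a - tau).
    by rewrite -{1}(subrK tau a); apply: gap; rewrite /M'; lra.
  have : logistic b <= logistic (a - tau) by apply: logistic_le; lra.
  by rewrite ler_normr => h; apply/orP; left; lra.
have g : c <= logistic (a + tau) - logistic a by apply: gap; rewrite /M'; lra.
have : logistic (a + tau) <= logistic b by apply: logistic_le; lra.
by rewrite ler_normr => h; apply/orP; right; lra.
Qed.

End Logistic.

Section LogisticAlgebra.
Context {R : realType} {d : nat}.
Local Notation E := 'rV[R]_d.

(** The algebra of functions generated by the constants and the logistic
    functions of the coordinates. *)
Inductive logistic_alg : (E -> R) -> Prop :=
| logistic_alg_cst c : logistic_alg (fun=> c)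
| logistic_alg_coord i : logistic_alg (fun x => logistic (x 0 i))
| logistic_alg_add f g : logistic_alg f -> logistic_alg g ->
    logistic_alg (fun x => f x + g x)
| logistic_alg_mul f g : logistic_alg f -> logistic_alg g ->
    logistic_alg (fun x => f x * g x).

Lemma logistic_alg_sum (J : finType) (F : J -> E -> R) :
  (forall j, logistic_alg (F j)) -> logistic_alg (fun x => \sum_j F j x).
Proof.
move=> HF; elim: (index_enum J) => [|j s IH].
  rewrite (_ : (fun x => _) = fun=> 0); first exact: logistic_alg_cst.
  by apply/funext => x; rewrite big_nil.
rewrite (_ : (fun x => _) = fun x => F j x + \sum_(i <- s) F i x).
  exact: logistic_alg_add.
by apply/funext => x; rewrite big_cons.
Qed.

Lemma logistic_alg_prod (J : finType) (F : J -> E -> R) :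
  (forall j, logistic_alg (F j)) -> logistic_alg (fun x => \prod_j F j x).
Proof.
move=> HF; elim: (index_enum J) => [|j s IH].
  rewrite (_ : (fun x => _) = fun=> 1); first exact: logistic_alg_cst.
  by apply/funext => x; rewrite big_nil.
rewrite (_ : (fun x => _) = fun x => F j x * \prod_(i <- s) F i x).
  exact: logistic_alg_mul.
by apply/funext => x; rewrite big_cons.
Qed.

Lemma logistic_alg_bounded_lipschitz f : logistic_alg f ->
  exists C : R, [/\ 0 <= C, forall x, `|f x| <= C &
    forall x y, `|f x - f y| <= C * enorm (x - y)].
Proof.
elim=> {f} [c|i|f g _ [C [C0 fC fL]] _ [D [D0 gD gL]]|f g _ [C [C0 fC fL]] _ [D [D0 gD gL]]].
- exists `|c|; split=> // x y; by rewrite subrr normr0 mulr_ge0// enorm_ge0.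
- exists 1; split=> // [x|x y].
    by rewrite ger0_norm ltW// ?logistic_lt1// logistic_gt0.
  rewrite mul1r; apply: le_trans (logistic_lip _ _) _.
  by have := coord_le_enorm (x - y) i; rewrite !mxE.
- exists (C + D); split=> [|x|x y]; first exact: addr_ge0.
    by apply: le_trans (ler_normD _ _) _; exact: lerD.
  rewrite (_ : _ - _ = (f x - f y) + (g x - g y)); last by ring.
  by rewrite mulrDl; apply: le_trans (ler_normD _ _) _; exact: lerD.
- exists (C * D + (C * D + C * D)); split=> [|x|x y].
  + by rewrite !addr_ge0// mulr_ge0.
  + rewrite normrM; apply: (@le_trans _ _ (C * D)); first exact: ler_pM.
    by rewrite lerDl addr_ge0// mulr_ge0.
  + rewrite (_ : _ - _ = f x * (g x - g y) + (f x - f y) * g y); last by ring.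
    apply: le_trans (ler_normD _ _) _; rewrite !normrM.
    have e0 := enorm_ge0 (x - y).
    have h1 : `|f x| * `|g x - g y| <= C * (D * enorm (x - y)) by exact: ler_pM.
    have h2 : `|f x - f y| * `|g y| <= C * enorm (x - y) * D by exact: ler_pM.
    have h3 : 0 <= C * D * enorm (x - y) by rewrite !mulr_ge0.
    lra.
Qed.

(** A bounded Lipschitz function has finite weighted Hoelder norm for every
    bounded weight and every exponent at most 1: distances at most 1 use the
    Lipschitz constant, larger ones the bound. *)
Lemma bounded_lipschitz_hle (alpha : R) (kappa f : E -> R) (C D : R) :
  0 < alpha <= 1 -> (forall x, 0 < kappa x) -> (forall x, kappa x <= D) ->
  0 <= C -> (forall x, `|f x| <= C) ->
  (forall x y, `|f x - f y| <= C * enorm (x - y)) ->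
  hle alpha kappa f (4 * (C * D)).
Proof.
move=> /andP[a0 a1] k0 kD C0 fC fL.
have D0 : 0 <= D by apply: le_trans (kD 0); exact: ltW.
have CD : 0 <= C * D by rewrite mulr_ge0.
have fw : wle kappa f (C * D) by move=> x; rewrite ler_pM// ltW.
split; first by apply: wle_le fw; lra.
move=> x y; have e0 := enorm_ge0 (x - y).
have [e1|e1] := leP 1 (enorm (x - y)).
  have : 1 <= enorm (x - y) `^ alpha.
    by have := ge0_ler_powR (ltW a0) _ _ e1; rewrite powR1; apply; rewrite nnegrE.
  have := wle_diff k0 fw x y; nra.
have b0 := kbar_gt0 x y k0.
have bD : kbar kappa x y <= 2 * D.
  by apply: le_trans (kbar_le_double x y k0) _; rewrite ler_wpM2l.
have ea : enorm (x - y) <= enorm (x - y) `^ alpha.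
  have [->|en0] := eqVneq (enorm (x - y)) 0; first exact: powR_ge0.
  have eE : enorm (x - y) = enorm (x - y) `^ alpha * enorm (x - y) `^ (1 - alpha).
    by rewrite -powRD ?en0 ?implybT// subrKC powRr1.
  have a1' : 0 <= 1 - alpha by rewrite subr_ge0.
  rewrite {1}eE ler_piMr ?powR_ge0//.
  by have := ge0_ler_powR a1' _ _ (ltW e1); rewrite powR1; apply; rewrite nnegrE.
apply: (@le_trans _ _ (C * enorm (x - y) * (2 * D))).
  by apply: ler_pM => //; exact: ltW.
rewrite (_ : _ * (2 * D) = 2 * (C * D) * enorm (x - y)); last by ring.
by apply: ler_pM => //; rewrite ?mulr_ge0//; lra.
Qed.

(** Continuity comes from the Hoelder bound for the constant weight 1. *)
Lemma logistic_alg_continuous f : logistic_alg f -> continuous f.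
Proof.
move=> /logistic_alg_bounded_lipschitz[C [C0 fC fL]].
apply: (@hle_continuous R d 1 (fun=> 1) f (4 * (C * 1))) => //.
  exact: cst_continuous.
by apply: bounded_lipschitz_hle => //; rewrite ltr01 lexx.
Qed.

Lemma is_derive_coord (F : R -> R) (F' : R) (x : E) i j :
  is_derive (x 0 j) 1 F F' ->
  is_derive x (delta_mx 0 i) (fun y : E => F (y 0 j)) ((i == j)%:R * F').
Proof.
move=> [dF <-]; have [->|ij] := eqVneq i j.
  have qE : (fun h : R => h^-1 *: (F ((h *: delta_mx 0 j + x) 0 j) - F (x 0 j))) =
      (fun h : R => h^-1 *: (F (h *: 1 + x 0 j) - F (x 0 j))).
    by apply/funext => h; rewrite !mxE !eqxx.
  split; first by rewrite /derivable/= qE.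
  by rewrite /derive/= qE mul1r.
have qE : (fun h : R => h^-1 *: (F ((h *: delta_mx 0 i + x) 0 j) - F (x 0 j))) = fun=> 0.
  apply/funext => h; rewrite !mxE eqxx eq_sym (negbTE ij) mulr0 add0r subrr.
  exact: scaler0.
split; first by rewrite /derivable/= qE; exact: is_cvg_cst.
by rewrite /derive/= qE mul0r; apply: cvg_lim => //; exact: cvg_cst.
Qed.

Lemma logistic_alg_derive f i : logistic_alg f -> exists2 g, logistic_alg g &
  forall x, is_derive x (delta_mx 0 i : E) f (g x).
Proof.
elim=> {f} [c|j|f g fA [f' fA' fd] gA [g' gA' gd]|f g fA [f' fA' fd] gA [g' gA' gd]].
- by exists (fun=> 0); [exact: logistic_alg_cst|move=> x; exact: is_derive_cst].
- exists (fun x => (i == j)%:R * (logistic (x 0 j) * (1 + (-1) * logistic (x 0 j)))).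
    by do ![apply: logistic_alg_cst|apply: logistic_alg_coord|
      apply: logistic_alg_mul|apply: logistic_alg_add].
  by move=> x; rewrite mulN1r; apply: is_derive_coord; exact: is_derive_logistic.
- exists (fun x => f' x + g' x); first exact: logistic_alg_add.
  by move=> x; exact: (is_deriveD (fd x) (gd x)).
- exists (fun x => f x * g' x + g x * f' x).
    by apply: logistic_alg_add; exact: logistic_alg_mul.
  by move=> x; exact: (is_deriveM (fd x) (gd x)).
Qed.

(** The algebra consists of bounded continuous functions and is stable under
    partial derivatives, so it consists of smooth bounded functions. *)
Lemma logistic_alg_Cbinfty f : logistic_alg f -> Cbinfty f.
Proof.
move=> fA.
have pA s : logistic_alg (pderiv s f).
  elim: s => [//|i s /(logistic_alg_derive i)[g gA dg]] /=.
  rewrite (_ : (fun x => _) = g)//.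
  by apply/funext => x; have [] := dg x.
move=> s; split; first exact: logistic_alg_continuous.
  move=> i x; have [g _ dg] := logistic_alg_derive i (pA s).
  by have [] := dg x.
by have [C [_ pC _]] := logistic_alg_bounded_lipschitz (pA s); exists C.
Qed.

End LogisticAlgebra.

(** * Bernstein operators in logistic coordinates *)

Section BinomialWeights.
Context {R : realType}.

(** The binomial weights with success probability [s], by Pascal's recursion. *)
Fixpoint bweight (N k : nat) (s : R) : R :=
  match N, k with
  | 0, 0 => 1
  | 0, _.+1 => 0
  | N'.+1, 0 => (1 - s) * bweight N' 0 s
  | N'.+1, k'.+1 => (1 - s) * bweight N' k s + s * bweight N' k' s
  end.

Lemma bweight_ge0 N k s : 0 <= s <= 1 -> 0 <= bweight N k s.
Proof.
move=> /andP[s0 s1]; have s1' : 0 <= 1 - s by lra.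
elim: N k => [|N IH] [|k] //=; first by rewrite mulr_ge0.
by rewrite addr_ge0 ?mulr_ge0.
Qed.

Lemma bweight_eq0 N k s : (N < k)%N -> bweight N k s = 0.
Proof.
elim: N k => [|N IH] [|k] //=; rewrite ltnS => Nk.
by rewrite !IH ?mulr0 ?addr0// ltnW.
Qed.

Lemma bweight_sumS N s (phi : nat -> R) :
  \sum_(k < N.+2) bweight N.+1 k s * phi k =
  (1 - s) * (\sum_(k < N.+1) bweight N k s * phi k) +
  s * (\sum_(k < N.+1) bweight N k s * phi k.+1).
Proof.
have shift : \sum_(k < N.+1) bweight N k s * phi k =
    bweight N 0 s * phi 0 + \sum_(k < N.+1) bweight N k.+1 s * phi k.+1.
  by rewrite big_ord_recl [in RHS]big_ord_recr /= (@bweight_eq0 N N.+1)// mul0r addr0.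
rewrite shift big_ord_recl /= mulrDr !mulr_sumr -addrA mulrA; congr (_ + _).
by rewrite -big_split; apply: eq_bigr => k _ /=; ring.
Qed.

Lemma bweight_sum N s : \sum_(k < N.+1) bweight N k s = 1.
Proof.
rewrite (eq_bigr (fun k : 'I_N.+1 => bweight N k s * 1)); last by move=> k; rewrite mulr1.
elim: N => [|N IH]; first by rewrite big_ord1 mulr1.
by rewrite (bweight_sumS N s (fun=> 1)) IH; ring.
Qed.

(** The second moment about [c] is the variance plus the squared bias. *)
Lemma bweight_moment2 N s (c : R) :
  \sum_(k < N.+1) bweight N k s * (k%:R - c) ^+ 2 =
  N%:R * s * (1 - s) + (N%:R * s - c) ^+ 2.
Proof.
elim: N c => [|N IH] c; first by rewrite big_ord1 /= !mul0r add0r; ring.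
rewrite (bweight_sumS N s (fun k => (k%:R - c) ^+ 2)) IH.
rewrite (eq_bigr (fun k : 'I_N.+1 => bweight N k s * (k%:R - (c - 1)) ^+ 2)).
  by rewrite IH -nat1r; ring.
by move=> k _; rewrite -nat1r; congr (_ * _ ^+ 2); ring.
Qed.

Lemma bweight_variance N s : 0 <= s <= 1 ->
  \sum_(k < N.+2) bweight N.+1 k s * (s - k%:R / N.+1%:R) ^+ 2 <= N.+1%:R^-1.
Proof.
move=> /andP[s0 s1]; set n : R := N.+1%:R.
have n0 : 0 < n by rewrite ltr0n.
have -> : \sum_(k < N.+2) bweight N.+1 k s * (s - k%:R / n) ^+ 2 =
    n^-1 ^+ 2 * \sum_(k < N.+2) bweight N.+1 k s * (k%:R - n * s) ^+ 2.
  rewrite mulr_sumr; apply: eq_bigr => k _; rewrite [RHS]mulrCA.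
  have -> : (s - k%:R / n) ^+ 2 = n^-1 ^+ 2 * (k%:R - n * s) ^+ 2.
    by field; rewrite gt_eqF.
  by [].
rewrite bweight_moment2 subrr expr0n addr0 -/n.
have -> : n^-1 ^+ 2 * (n * s * (1 - s)) = n^-1 * (s * (1 - s)).
  by field; rewrite gt_eqF.
by rewrite ler_piMr ?invr_ge0 ?(ltW n0)//; nra.
Qed.

End BinomialWeights.

Section BernsteinOperators.
Context {R : realType} {d : nat}.
Local Notation E := 'rV[R]_d.
Variable N : nat.
Local Notation J := {ffun 'I_d -> 'I_N.+2}.

(** The weight at [x] of the node [j / (N + 1)] of the unit cube: the product over
    the coordinates of the binomial weights, whose success probabilities are the
    logistic images of the coordinates of [x]. *)
Definition bernstein_weight (j : J) (x : E) : R :=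
  \prod_i bweight N.+1 (j i) (logistic (x 0 i)).

(** The Bernstein operator, as a function of the prescribed values at the
    nodes. *)
Definition bernstein (c : J -> R) (x : E) : R :=
  \sum_j bernstein_weight j x * c j.

Let logistic01 (t : R) : 0 <= logistic t <= 1.
Proof. by rewrite !ltW ?logistic_gt0 ?logistic_lt1. Qed.

Lemma bernstein_weight_ge0 j x : 0 <= bernstein_weight j x.
Proof. by apply: prodr_ge0 => i _; exact: bweight_ge0. Qed.

Lemma bernstein_weight_sum x : \sum_j bernstein_weight j x = 1.
Proof.
rewrite /bernstein_weight -(bigA_distr_bigA (fun (i : 'I_d) (k : 'I_N.+2) => bweight N.+1 k (logistic (x 0 i)))).
by rewrite big1// => i _; exact: bweight_sum.
Qed.

(** Under the product weights a single coordinate of the node is binomial. *)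
Lemma bernstein_weight_marginal x i0 (phi : nat -> R) :
  \sum_j bernstein_weight j x * phi (j i0) =
  \sum_(k < N.+2) bweight N.+1 k (logistic (x 0 i0)) * phi k.
Proof.
pose F i (k : 'I_N.+2) :=
  bweight N.+1 k (logistic (x 0 i)) * (if i == i0 then phi k else 1).
rewrite (eq_bigr (fun j : J => \prod_i F i (j i))); last first.
  move=> j _; rewrite big_split/=; congr (_ * _).
  rewrite (bigD1 i0)//= eqxx big1 ?mulr1// => i /negbTE ->//.
rewrite -(bigA_distr_bigA F) (bigD1 i0)//= [X in _ * X]big1 ?mulr1.
  by apply: eq_bigr => k _; rewrite /F eqxx.
move=> i /negbTE ii; rewrite -[RHS](bweight_sum N.+1 (logistic (x 0 i))).
by apply: eq_bigr => k _; rewrite /F ii mulr1.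
Qed.

Lemma bweight_alg k m i : logistic_alg (fun x : E => bweight m k (logistic (x 0 i))).
Proof.
elim: m k => [|m IH] [|k] /=; try exact: logistic_alg_cst.
  have -> : (fun x : E => (1 - logistic (x 0 i)) * bweight m 0 (logistic (x 0 i))) =
      (fun x : E => (1 + (-1) * logistic (x 0 i)) * bweight m 0 (logistic (x 0 i))).
    by apply/funext => x; ring.
  apply: logistic_alg_mul (IH 0%N).
  apply: logistic_alg_add; first exact: logistic_alg_cst.
  by apply: logistic_alg_mul; [exact: logistic_alg_cst|exact: logistic_alg_coord].
have -> : (fun x : E => (1 - logistic (x 0 i)) * bweight m k.+1 (logistic (x 0 i)) +
      logistic (x 0 i) * bweight m k (logistic (x 0 i))) =
    (fun x : E => (1 + (-1) * logistic (x 0 i)) * bweight m k.+1 (logistic (x 0 i)) +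
      logistic (x 0 i) * bweight m k (logistic (x 0 i))).
  by apply/funext => x; ring.
apply: logistic_alg_add.
  apply: logistic_alg_mul (IH k.+1).
  apply: logistic_alg_add; first exact: logistic_alg_cst.
  by apply: logistic_alg_mul; [exact: logistic_alg_cst|exact: logistic_alg_coord].
by apply: logistic_alg_mul (IH k); exact: logistic_alg_coord.
Qed.

Lemma bernstein_alg c : logistic_alg (bernstein c).
Proof.
apply: logistic_alg_sum => j; apply: logistic_alg_mul; last exact: logistic_alg_cst.
by apply: logistic_alg_prod => i; exact: bweight_alg.
Qed.

(** By Chebyshev's inequality the nodes at distance more than [rho] from the image
    of [x] have small total weight. *)
Lemma bernstein_error (c : J -> R) (x : E) (v delta B rho : R) :
  0 < rho -> 0 <= delta -> 0 <= B ->
  (forall j : J, (forall i, `|logistic (x 0 i) - (j i)%:R / N.+1%:R| <= rho) ->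
     `|c j - v| <= delta) ->
  (forall j, `|c j - v| <= B) ->
  `|bernstein c x - v| <= delta + B * (d%:R / (rho ^+ 2 * N.+1%:R)).
Proof.
move=> rho0 delta0 B0 near_ far.
pose dev i (k : nat) := (logistic (x 0 i) - k%:R / N.+1%:R) ^+ 2.
have dev0 i k : 0 <= dev i k by exact: sqr_ge0.
have pointwise j : `|c j - v| <= delta + B / rho ^+ 2 * \sum_i dev i (j i).
  have Br0 : 0 <= B / rho ^+ 2 by rewrite divr_ge0// sqr_ge0.
  have [H|] := pselect (forall i, `|logistic (x 0 i) - (j i)%:R / N.+1%:R| <= rho).
    by apply: le_trans (near_ j H) _; rewrite lerDl mulr_ge0// sumr_ge0.
  move=> /existsNP[i /negP]; rewrite -ltNge => H.
  apply: le_trans (far j) _; apply: (@le_trans _ _ (B / rho ^+ 2 * \sum_i dev i (j i))).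
    rewrite -mulrA ler_peMr// mulrC ler_pdivlMr ?exprn_gt0// mul1r (bigD1 i)//=.
    apply: (@le_trans _ _ (dev i (j i))); last by rewrite lerDl sumr_ge0.
    by rewrite /dev -[leRHS]real_normK ?num_real// lerXn2r ?nnegrE ?normr_ge0 ?(ltW rho0) ?(ltW H).
  by rewrite lerDr.
have -> : bernstein c x - v = \sum_j bernstein_weight j x * (c j - v).
  rewrite -[X in _ - X]mul1r -(bernstein_weight_sum x) mulr_suml /bernstein -sumrB.
  by apply: eq_bigr => j _; rewrite mulrBr.
apply: le_trans (ler_norm_sum _ _ _) _.
apply: (@le_trans _ _ (\sum_j bernstein_weight j x * (delta + B / rho ^+ 2 * \sum_i dev i (j i)))).
  apply: ler_sum => j _; rewrite normrM ger0_norm ?bernstein_weight_ge0//.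
  by rewrite ler_wpM2l// bernstein_weight_ge0.
rewrite (eq_bigr (fun j => bernstein_weight j x * delta +
    B / rho ^+ 2 * \sum_i bernstein_weight j x * dev i (j i))); last first.
  by move=> j _; rewrite mulrDr [X in _ + X]mulrCA -mulr_sumr.
rewrite big_split/= -mulr_suml bernstein_weight_sum mul1r lerD2l -mulr_sumr.
rewrite exchange_big/= (eq_bigr (fun i => \sum_(k < N.+2) bweight N.+1 k (logistic (x 0 i)) * dev i k)); last first.
  by move=> i _; exact: bernstein_weight_marginal.
rewrite -mulrA ler_wpM2l// [in leRHS]invfM [leRHS]mulrCA ler_wpM2l ?invr_ge0 ?sqr_ge0//.
rewrite mulr_natl -[d in leRHS]card_ord -sumr_const; apply: ler_sum => i _.
exact: bweight_variance.
Qed.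

End BernsteinOperators.

(** * Finitely many smooth functions represent a Hoelder ball *)

Section FiniteDensity.
Context {R : realType} {d : nat}.
Local Notation E := 'rV[R]_d.
Variables (alpha : R) (kappa : E -> R).
Hypothesis kappa_cont : continuous kappa.
Hypothesis kappa_gt0 : forall x, 0 < kappa x.
Hypothesis alpha_gt0 : 0 < alpha.

Lemma compact_maxball (L : R) : compact [set x : E | `|x| <= L].
Proof.
apply: bounded_closed_compact.
  by exists L; split; [exact: num_real|move=> M LM x /= /le_trans; apply; exact: ltW].
apply: (@closed_comp _ _ (fun x : E => `|x|) [set t | t <= L]); last exact: closed_le.
by move=> x _; exact: norm_continuous.
Qed.

Lemma weight_min (L : R) : 0 <= L ->
  exists2 m : R, 0 < m & forall x : E, `|x| <= L -> m <= kappa x.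
Proof.
move=> L0; have ne : [set x : E | `|x| <= L] !=set0 by exists 0; rewrite /= normr0.
have [c _ cmin] := EVT_min_rV ne (@compact_maxball L)
  (continuous_subspaceT kappa_cont).
by exists (kappa c) => // x xL; apply: cmin; rewrite inE.
Qed.

(** A Lipschitz cutoff that is 1 on the ball of radius [L] and 0 outside the
    ball of radius [L + 1]; here and below, balls are those of the maximum norm. *)
Definition cutoff (L : R) (x : E) : R := Num.max 0 (Num.min 1 (L + 1 - `|x|)).

Lemma cutoff01 L x : 0 <= cutoff L x <= 1.
Proof.
rewrite /cutoff le_max lexx/= ge_max ler01/= ge_min lexx//.
Qed.

Lemma cutoff_eq1 L x : `|x| <= L -> cutoff L x = 1.
Proof.
move=> xL; rewrite /cutoff min_l; last lra.
by rewrite max_r.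
Qed.

Lemma cutoff_eq0 L x : L + 1 < `|x| -> cutoff L x = 0.
Proof.
by move=> xL; rewrite /cutoff max_l// ge_min; apply/orP; right; lra.
Qed.

Lemma cutoff_lip L x y : `|cutoff L x - cutoff L y| <= `|x - y|.
Proof.
have clamp (s : R) : Num.max 0 (Num.min 1 s) =
    if s <= 0 then 0 else if 1 <= s then 1 else s.
  by case: (leP s 0) => ?; case: (leP 1 s) => ?; case: leP => ?; lra.
have := ler_dist_dist x y; rewrite ler_norml => /andP[h1 h2].
rewrite /cutoff !clamp ler_norml; apply/andP.
by case: (leP (L + 1 - `|x|) 0) => ?; case: (leP 1 (L + 1 - `|x|)) => ?;
  case: (leP (L + 1 - `|y|) 0) => ?; case: (leP 1 (L + 1 - `|y|)) => ?; split; lra.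
Qed.

(** The truncations of a Hoelder ball are equicontinuous with respect to the
    coordinatewise logistic distance. *)
Lemma truncation_equicontinuous (r L delta : R) :
  0 <= r -> 0 <= L -> 0 < delta -> exists2 rho : R, 0 < rho &
  forall f (x y : E), hle alpha kappa f r ->
    (forall i, `|logistic (x 0 i) - logistic (y 0 i)| <= rho) ->
    `|f x * cutoff L x - f y * cutoff L y| <= delta.
Proof.
move=> r0 L0 delta0.
have L2 : 0 <= L + 2 by lra.
have [m m0 mP] := weight_min L2.
have B0 : 0 <= r / m by rewrite divr_ge0// ltW.
have d2 : 0 < delta / 2 by rewrite divr_gt0.
have [rho0 rho00 small] := powR_small alpha_gt0 B0 d2.
have d1 : 0 < (d%:R : R) + 1 by rewrite ltr_wpDl.
have B1 : 0 < r / m + 1 by lra.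
pose tau := Num.min 1 (Num.min (rho0 / (d%:R + 1)) (delta / 2 / (r / m + 1))).
have tau0 : 0 < tau by rewrite !lt_min ltr01 !divr_gt0.
have [rho rho_gt0 sep] := logistic_separation (L + 1) tau0.
exists rho => //; move=> f x y fr.
(* If both points are outside the support of the cutoff, the difference is 0. *)
wlog xL : x y / `|x| <= L + 1.
  move=> H xy; have [xL|xL] := leP `|x| (L + 1); first exact: H.
  have [yL|yL] := leP `|y| (L + 1).
    by rewrite distrC; apply: H => // i; rewrite distrC.
  by rewrite !cutoff_eq0// !mulr0 subrr normr0 ltW.
move=> xy.
have xyt : `|x - y| <= tau.
  rewrite {1}/Num.norm/= mx_normrE; apply: bigmax_le; first exact: ltW.
  move=> [i j] _ /=; rewrite (ord1 i) !mxE; apply: sep => //.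
  by apply: le_trans xL; exact: coord_le_normr.
move: (xyt); rewrite !le_min => /and3P[t1 t2 t3].
have yL : `|y| <= L + 2.
  have := ler_normB x (x - y); rewrite subKr; lra.
have xL2 : `|x| <= L + 2 by lra.
have fxy : `|f x - f y| <= delta / 2.
  apply: le_trans (hle_local m0 (mP _ xL2) (mP _ yL) fr) _.
  apply: small; rewrite enorm_ge0/=; apply: le_trans (enorm_le_normr _) _.
  move: t2; rewrite ler_pdivlMr//; have := normr_ge0 (x - y); lra.
have fy : `|f y| <= r / m.
  rewrite ler_pdivlMr//; apply: le_trans (fr.1 y).
  by rewrite ler_wpM2l// mP.
have -> : f x * cutoff L x - f y * cutoff L y =
    (f x - f y) * cutoff L x + f y * (cutoff L x - cutoff L y) by ring.
apply: le_trans (ler_normD _ _) _; rewrite !normrM [leRHS]splitr; apply: lerD.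
  have /andP[c0 c1] := cutoff01 L x.
  by rewrite -[leRHS]mulr1 (ger0_norm c0) ler_pM.
apply: (@le_trans _ _ (r / m * (delta / 2 / (r / m + 1)))).
  by apply: ler_pM => //; apply: le_trans t3; exact: cutoff_lip.
rewrite mulrCA ler_piMr ?(ltW d2)// ler_pdivrMr// mul1r; lra.
Qed.

(** Rounding to a finite grid of mesh [eta]. *)
Lemma finite_grid (B eta : R) : 0 <= B -> 0 < eta -> exists Q : nat,
  forall c, `|c| <= B -> exists q : 'I_Q.+1, `|- B + q%:R * eta - c| <= eta.
Proof.
move=> B0 eta0; exists (Num.truncn (2 * B / eta)) => c.
rewrite ler_norml => /andP[c1 c2].
have q0 : 0 <= (c + B) / eta by rewrite divr_ge0 ?(ltW eta0)//; lra.
have qle : (Num.truncn ((c + B) / eta) < (Num.truncn (2 * B / eta)).+1)%N.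
  rewrite ltnS truncn_ge_nat; last by rewrite divr_ge0 ?mulr_ge0// ltW.
  apply: (@le_trans _ _ ((c + B) / eta)); first by rewrite -truncn_ge_nat.
  by rewrite ler_wpM2r ?invr_ge0 ?(ltW eta0)//; lra.
exists (Ordinal qle) => /=; set k := Num.truncn _.
have := truncn_itv q0; rewrite -/k => /andP[k1 k2].
move: k1 k2; rewrite ler_pdivlMr// ltr_pdivrMr// -natr1 mulrDl mul1r => k1 k2.
by rewrite ler_norml; apply/andP; split; lra.
Qed.

(** Up to an error [delta] on the ball of radius [L], a whole Hoelder ball is
    represented by a finite family of smooth bounded functions. The global bound
    on the representatives keeps them in a ball of the weighted space that does
    not depend on [L]. The family consists of the Bernstein operators of all
    node values in a finite grid. *)
Lemma finite_smooth_family (r L delta : R) : 0 <= r -> 0 <= L -> 0 < delta ->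
  exists (J : finType) (p : J -> E -> R),
    (forall j, logistic_alg (p j)) /\
    forall f, hle alpha kappa f r -> exists j,
      (forall x, `|x| <= L -> `|f x - p j x| <= delta) /\
      (forall x, `|p j x| <= `|f x| + delta).
Proof.
move=> r0 L0 delta0.
have L1 : 0 <= L + 1 by lra.
have [m m0 mP] := weight_min L1.
pose B := r / m.
have B0 : 0 <= B by rewrite divr_ge0// ltW.
have d4 : 0 < delta / 4 by rewrite divr_gt0.
have [rho2 rho20 equi] := truncation_equicontinuous r0 L0 d4.
pose rho := rho2 / 2.
have rho0 : 0 < rho by rewrite divr_gt0.
have [Q grid] := finite_grid B0 d4.
pose B' := delta / 4 + B + B.
have B'0 : 0 <= B' by rewrite /B'; lra.
have [N NP] : exists N : nat, B' * (d%:R / (rho ^+ 2 * N.+1%:R)) <= delta / 2.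
  pose z := 2 * (B' * d%:R / rho ^+ 2) / delta.
  have z0 : 0 <= z by rewrite !mulr_ge0 ?invr_ge0 ?sqr_ge0 ?(ltW delta0).
  exists (Num.truncn z).
  have /andP[_ zN] := truncn_itv z0.
  have n0 : 0 < (Num.truncn z).+1%:R :> R by rewrite ltr0n.
  have -> : B' * (d%:R / (rho ^+ 2 * (Num.truncn z).+1%:R)) =
      z * delta / 2 / (Num.truncn z).+1%:R.
    by rewrite /z; field; rewrite !gt_eqF.
  rewrite ler_pdivrMr// -mulrA [leRHS]mulrC; apply: ler_wpM2r; last exact: ltW.
  by rewrite divr_ge0// ltW.
pose node := {ffun 'I_d -> 'I_N.+2}.
pose val_ (q : {ffun node -> 'I_Q.+1}) (j : node) : R := - B + (q j)%:R * (delta / 4).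
exists {ffun node -> 'I_Q.+1}, (fun q => bernstein (val_ q)); split.
  by move=> q; exact: bernstein_alg.
move=> f fr; pose g x := f x * cutoff L x.
have gB x : `|g x| <= B.
  rewrite /g normrM; have /andP[c0 c1] := cutoff01 L x.
  have [xL|xL] := leP `|x| (L + 1); last by rewrite cutoff_eq0// normr0 mulr0.
  apply: (@le_trans _ _ `|f x|); first by rewrite (ger0_norm c0) ler_piMr.
  rewrite /B ler_pdivlMr//; apply: le_trans (fr.1 x).
  by rewrite ler_wpM2l// mP.
(* The coefficient at a node is the value of the truncation at some point whose
   image is close to the node, if there is one. *)
pose close (j : node) (x : E) := forall i, `|logistic (x 0 i) - (j i)%:R / N.+1%:R| <= rho.
have /choice[c cP] : forall j : node, exists c : R,
    `|c| <= B /\ forall x, close j x -> `|c - g x| <= delta / 4.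
  move=> j; have [[x0 jx0]|no] := pselect (exists x, close j x); last first.
    by exists 0; split; [rewrite normr0|move=> x jx; case: no; exists x].
  exists (g x0); split=> // x jx; apply: equi => // i.
  apply: le_trans (ler_distD ((j i)%:R / N.+1%:R) _ _) _.
  rewrite [X in _ + X]distrC; have := jx0 i; have := jx i; rewrite /rho; lra.
have /choice[q qP] : forall j : node, exists q : 'I_Q.+1,
    `|- B + q%:R * (delta / 4) - c j| <= delta / 4.
  by move=> j; exact: grid (cP j).1.
have err x : `|bernstein (val_ [ffun j => q j]) x - g x| <= delta.
  have := @bernstein_error R d N (val_ [ffun j => q j]) x (g x) (delta / 2) B' rho
    rho0 (ltW (divr_gt0 delta0 (ltr0n _ 2))) B'0.
  move=> H; rewrite [leRHS]splitr; apply: le_trans (H _ _) _; last by rewrite lerD2l.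
    move=> j jx; have := (cP j).2 x jx; have := qP j.
    have := ler_distD (c j) (val_ [ffun j => q j] j) (g x).
    rewrite /val_ ffunE; lra.
  move=> j; have := qP j; have := (cP j).1; have := gB x.
  have := ler_distD (c j) (val_ [ffun j => q j] j) (g x).
  have := ler_normB (c j) (g x).
  rewrite /val_ ffunE /B'; lra.
exists [ffun j => q j]; split=> x.
  by move=> xL; have := err x; rewrite distrC /g cutoff_eq1// mulr1.
have gf : `|g x| <= `|f x|.
  by rewrite /g normrM; have /andP[c0 c1] := cutoff01 L x; rewrite (ger0_norm c0) ler_piMr.
have := err x; have := ler_normD (bernstein (val_ [ffun j => q j]) x - g x) (g x).
rewrite subrK; lra.
Qed.

End FiniteDensity.

(** * Convergence of the envelope iterates to the semigroup *)

Section Convergence.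
Context {R : realType} {d : nat} {Lambda : Type}.
Local Notation E := 'rV[R]_d.
Variables (kappa : E -> R) (I : nat -> Lambda -> (E -> R) -> (E -> R))
  (etan : nat -> Lambda -> \bar R) (eta : Lambda -> \bar R) (h : nat -> R)
  (lambda0 : nat -> Lambda) (omega alpha : R).
Hypothesis kappa_weight : bounded_weight kappa.
Hypothesis etan_ge0 : forall n l, (0 <= etan n l)%E.
Hypothesis h_gt0 : forall n, 0 < h n.
Hypothesis h_cvg0 : h @ \oo --> (0 : R).
Hypothesis alpha_itv : 0 < alpha <= 1.
Hypothesis envelope : envelope_conditions kappa I etan eta h lambda0 omega.
Hypothesis stability : hoelder_stable kappa I h omega alpha.
Implicit Types (f g p : E -> R).

Let kappa_cont : continuous kappa. Proof. by case: kappa_weight. Qed.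
Let kappa_gt0 : forall x, 0 < kappa x. Proof. by case: kappa_weight. Qed.
Let env : envelope_common kappa I etan h lambda0 omega.
Proof. by case: envelope. Qed.
Let alpha_gt0 : 0 < alpha. Proof. by case/andP: alpha_itv. Qed.

Local Notation J := (Iop I etan h).
Local Notation it n t f := (iter_pi h (J n) n t f).

Let JE n := Iop_is_envelope kappa_gt0 etan_ge0 h_gt0 env n.
Let J0 n : [set l | (etan n l < +oo)%E] (lambda0 n).
Proof. by rewrite /= (env_zero env) ltry. Qed.

Lemma lty_real_bound (x : \bar R) : (x < +oo)%E -> exists c : R, (x <= c%:E)%E.
Proof.
by case: x => [c| |] //= _; [exists c|exists 0; rewrite leNye].
Qed.

Lemma mixed_cvg_uniform (u : nat -> E -> R) g (L e : R) :
  mixed_cvg kappa u g -> 0 < e ->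
  exists N, forall n x, (N <= n)%N -> `|x| <= L -> `|g x - u n x| <= e.
Proof.
move=> [_ _ _ /(_ _ (@compact_maxball R d L)) ug] e0.
have /fine_cvgP[finN /cvgrPdist_le/(_ _ e0) ule] := ug.
have [N _ NP] := filterI finN ule.
exists N => n x Nn xL; have [fn] := NP n Nn.
rewrite /= sub0r normrN => /(le_trans (ler_norm _)) fe.
apply: (proj1 (@supnorm_leP R d [set x : E | `|x| <= L] (g \- u n) e (ltW e0))) => //.
by rewrite -(fineK fn) lee_fin.
Qed.

(** One step moves a smooth bounded function by at most a multiple of [h n] in
    the weighted supremum norm. *)
Lemma smooth_step_rate p : Cbinfty p -> Ck kappa p -> exists (C : R) (n0 : nat),
  0 <= C /\ forall n, (n0 <= n)%N -> wle kappa (J n p \- p) (C * h n).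
Proof.
move=> pS pC; have [_ [D' kD']] := (let: And3 a b c := kappa_weight in conj a c).
(* If the one-step difference quotients converge, they are bounded in norm.
   Otherwise the bound is the supremum of those for the relevant parameters, and
   their penalties, bounded in the supremum norm, are also bounded in the weighted
   norm since the weight is bounded. *)
have [_ [der|[_ gens]]] := envelope.
  have [g [_ _ bnd _]] := der p pS.
  have [C CP] := lty_real_bound bnd.
  have w n : wle kappa (diff_quot h (J n) n p) C.
    apply/wnorm_leP; apply: le_trans CP; apply: ereal_sup_ubound.
    by exists n.
  exists C, 0%N; split; first exact: wle_ge0 kappa_gt0 (w 0%N).
  move=> n _ x; have := w n x.
  rewrite /diff_quot normrM normfV (gtr0_norm (h_gt0 n)).
  by rewrite mulrAC ler_pdivrMr.
have [c [n0 [L0 [c0 [supE [_ [bnd [close _]]]]]]]] := gens p pS.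
have [b bP] := lty_real_bound bnd.
have etab n l : L0 l -> (etan n l <= b%:E)%E.
  move=> Ll; apply: le_trans bP; apply: le_trans (ereal_sup_ubound _); last by exists n.
  by apply: ereal_sup_ubound; exists l.
pose b' := Num.max b 0.
have b'0 : 0 <= b' by rewrite le_max lexx orbT.
have D0 : 0 <= D' by apply: le_trans (kD' 0); exact: ltW.
exists (c + b' * D'), n0; split; first by rewrite addr_ge0// mulr_ge0.
move=> n n0n x; have hn := h_gt0 n; have kx := kappa_gt0 x.
have fin : env_sup I etan h L0 n p x \is a fin_num.
  by rewrite -supE//; exact: (env_sup_setT_fin kappa_gt0 etan_ge0 h_gt0 env).
have lclose l : L0 l -> `|I n l p x - p x| <= c * h n / kappa x.
  move=> Ll; rewrite ler_pdivlMr//.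
  have /wnorm_leP/(_ x)// : (wnorm kappa (I n l p \- p)%R <= (c * h n)%:E)%E.
  by apply: le_trans (close n n0n); apply: ereal_sup_ubound; exists l.
have bk : b' * h n <= b' * D' * h n / kappa x.
  rewrite ler_pdivlMr// mulrAC ler_wpM2r ?(ltW hn)//.
  by rewrite ler_wpM2l.
have JpE : J n p x = fine (env_sup I etan h L0 n p x) by rewrite /Iop supE.
have up : J n p x <= p x + c * h n / kappa x.
  rewrite JpE; apply: env_sup_lub => // l Ll _.
  have := lclose l Ll; rewrite ler_norml => /andP[_].
  have : 0 <= fine (etan n l) * h n by rewrite mulr_ge0 ?fine_ge0// ltW.
  by rewrite /penalised; lra.
have lo : p x - c * h n / kappa x - b' * h n <= J n p x.
  have [l Ll] : L0 !=set0.
    apply/set0P; apply/eqP => L00; move: fin.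
    by rewrite /env_sup L00 image_set0 ereal_sup0.
  have le : (etan n l < +oo)%E by apply: le_lt_trans (etab n l Ll) _; rewrite ltry.
  rewrite JpE; apply: le_trans (env_sup_ub etan_ge0 fin Ll le).
  have := lclose l Ll; rewrite ler_norml => /andP[+ _].
  have : fine (etan n l) * h n <= b' * h n.
    rewrite ler_wpM2r ?(ltW hn)// -lee_fin fineK ?ge0_fin_numE//.
    by apply: le_trans (etab n l Ll) _; rewrite lee_fin le_max lexx.
  by rewrite /penalised; lra.
rewrite -ler_pdivlMr//= mulrDl mulrDl ler_norml.
have : 0 <= b' * D' * h n / kappa x by rewrite !mulr_ge0 ?invr_ge0// ltW.
by move=> ?; apply/andP; split; lra.
Qed.

(** The error [h n] in the time increment comes from rounding the times to
    multiples of [h n]. *)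
Lemma smooth_time_regularity p b C n (s t T : R) :
  hle alpha kappa p b -> 0 <= C -> wle kappa (J n p \- p) (C * h n) ->
  0 <= s -> s <= t -> t <= T ->
  wle kappa (it n t p \- it n s p) (expR (omega * T) * (C * (t - s + h n))).
Proof.
move=> pb C0 step s0 st tT.
have t0 : 0 <= t by exact: le_trans st.
have ks := nsteps_le h_gt0 n (t := s) (T := t) (introT andP (conj s0 st)).
have Ch : 0 <= C * h n by rewrite mulr_ge0// ltW.
have := envelope_iter_step_wle kappa_cont kappa_gt0 etan_ge0 h_gt0 alpha_gt0 env
  stability (J0 n) (@JE n) (nsteps h n s) (nsteps h n t - nsteps h n s) pb Ch step.
rewrite subnKC//; apply: wle_le.
apply: ler_pM; rewrite ?exprn_ge0 ?expR_ge0 ?mulr_ge0 ?(ltW (h_gt0 n))//.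
  apply: (growth_iter_le h_gt0 env (t := t)) => //.
  by rewrite t0.
rewrite mulrCA ler_wpM2l// natrB// mulrBl.
have k1 : (nsteps h n t)%:R * h n <= t by rewrite -nsteps_max.
have k2 : s < (nsteps h n s).+1%:R * h n.
  by rewrite ltNge -nsteps_max// ltnn.
move: k2; rewrite -natr1 mulrDl mul1r; lra.
Qed.

Variable S : R -> (E -> R) -> (E -> R).
Hypothesis S_lim : forall t f, 0 <= t -> Ck kappa f ->
  mixed_cvg kappa (fun n => it n t f) (S t f).

(** The iterates converge uniformly on compact sets, on bounded time intervals
    and on Hoelder balls: a ball is represented by finitely many smooth functions,
    a time interval by finitely many instants, and the index [N] only depends on
    the convergence at these. *)
Lemma uniform_convergence (r T L e : R) : 0 <= r -> 0 <= T -> 0 <= L -> 0 < e ->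
  exists N, forall n f t x, (N <= n)%N -> hle alpha kappa f r ->
    0 <= t <= T -> `|x| <= L -> `|S t f x - it n t f x| <= e.
Proof.
move=> r0 T0 L0 e0.
have [D kD] : exists D, forall x, kappa x <= D by case: kappa_weight.
have D0 : 0 < D by apply: lt_le_trans (kD 0).
have [m m0 mP] := weight_min kappa_cont kappa_gt0 L0.
pose e1 := e / 10.
have e10 : 0 < e1 by rewrite divr_gt0.
have r1 : 0 <= r + 1 by lra.
have [c [K' [c0 cK' locP]]] := env_local env e10 r1 T0 (@compact_maxball R d L).
have [M0 [_ M0P]] := compact_bounded cK'.
pose L' := Num.max 0 (M0 + 1).
have L'0 : 0 <= L' by rewrite le_max lexx.
have K'L x : K' x -> `|x| <= L'.
  by apply: M0P; rewrite lt_max; apply/orP; right; lra.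
(* The first bound on [delta] keeps the representatives in the ball of radius
   [r + 1] of the weighted space, the second one makes the local modulus of
   continuity of the iterates contribute at most [e1]. *)
pose delta := Num.min D^-1 (e1 / (c + 1)).
have c1 : 0 < c + 1 by lra.
have delta0 : 0 < delta by rewrite lt_min invr_gt0 D0 divr_gt0.
have [F [p [pA dense]]] :=
  finite_smooth_family kappa_cont kappa_gt0 alpha_gt0 r0 L'0 delta0.
have /choice[b pb] : forall j, exists b, hle alpha kappa (p j) b.
  move=> j; have [C [C0 pC pL]] := logistic_alg_bounded_lipschitz (pA j).
  by exists (4 * (C * D)); exact: bounded_lipschitz_hle.
have pC j := hle_Ck kappa_cont kappa_gt0 alpha_gt0 (pb j).
have /choice[C /choice[n0 rate]] : forall j, exists (C : R) (n0 : nat),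
    0 <= C /\ forall n, (n0 <= n)%N -> wle kappa (J n (p j) \- p j) (C * h n).
  by move=> j; exact: smooth_step_rate (logistic_alg_Cbinfty (pA j)) (pC j).
pose Q := expR (omega * T).
have Q0 : 0 <= Q by exact: expR_ge0.
pose Cs := \sum_j C j.
have Cs0 : 0 <= Cs by apply: sumr_ge0 => j _; case: (rate j).
have CCs j : C j <= Cs.
  by rewrite /Cs (bigD1 j)//= lerDl sumr_ge0// => i _; case: (rate i).
have QC : 0 < Q * Cs * 2 + 1 by rewrite ltr_wpDl// !mulr_ge0.
(* With time increment and step size at most [tau], smooth representatives move
   by at most [e1] on the ball of radius [L], where the weight is at least [m]. *)
pose tau := e1 * m / (Q * Cs * 2 + 1).
have tau0 : 0 < tau by rewrite divr_gt0// mulr_gt0.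
have [N1 _ hN1] : \forall n \near \oo, h n <= tau.
  have /cvgrPdist_le/(_ _ tau0) := h_cvg0; apply: filterS => n /=.
  by rewrite sub0r normrN => /(le_trans (ler_norm _)).
pose Mt := Num.truncn (T / tau).
have grid_ge0 (i : nat) : 0 <= i%:R * tau by rewrite mulr_ge0// ltW.
have /choice[N2 N2P] : forall ji : F * 'I_Mt.+1, exists N, forall n x,
    (N <= n)%N -> `|x| <= L ->
    `|S (ji.2%:R * tau) (p ji.1) x - it n (ji.2%:R * tau) (p ji.1) x| <= e1.
  move=> [j i] /=; apply: mixed_cvg_uniform e10.
  exact: S_lim.
pose N := maxn N1 (maxn (\max_j n0 j) (\max_ji N2 ji)).
(* Compare with a representative [p j] at a grid time, where the iterates are close
   to the semigroup. *)
have key n f t x j (i : 'I_Mt.+1) : (N <= n)%N -> hle alpha kappa f r -> 0 <= t <= T ->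
    `|x| <= L -> (forall y, `|y| <= L' -> `|f y - p j y| <= delta) ->
    (forall y, `|p j y| <= `|f y| + delta) ->
    i%:R * tau <= t -> t <= i%:R * tau + tau ->
    `|it n t f x - S (i%:R * tau) (p j) x| <= 4 * e1.
  rewrite !geq_max => /and3P[nN1 nn0 nN2] fr tT xL fp pf it1 it2.
  have /andP[t0 tT'] := tT.
  have a1 : `|it n t f x - it n t (p j) x| <= 2 * e1.
    have fB : ball_Ck kappa (r + 1) f.
      apply/ball_CkP; split; last by apply: wle_le fr.1; lra.
      by have [] := hle_Ck kappa_cont kappa_gt0 alpha_gt0 fr.
    have pB : ball_Ck kappa (r + 1) (p j).
      apply/ball_CkP; split; first by have [] := pC j.
      move=> y; apply: (@le_trans _ _ ((`|f y| + delta) * kappa y)).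
        by rewrite ler_wpM2r// ltW.
      rewrite mulrDl lerD//; first exact: fr.1.
      apply: (@le_trans _ _ (D^-1 * D)); last by rewrite mulVf// gt_eqF.
      by rewrite ler_pM// ?(ltW delta0) ?(ltW (kappa_gt0 y))// ge_min lexx.
    have sK : (supnorm K' (f \- p j)%R <= delta%:E)%E.
      by apply/supnorm_leP => [|y /K'L]; [exact: ltW|exact: fp].
    have lb : 0 <= c * delta + e1 by rewrite addr_ge0 ?mulr_ge0// ltW.
    have /(supnorm_leP _ _ lb)/(_ x xL) /= : (supnorm [set x : E | (`|x| <= L)%R]
        (it n t f \- it n t (p j))%R <= (c * delta + e1)%:E)%E.
      apply: le_trans (locP t n f (p j) tT fB pB) _.
      by rewrite EFinD; apply: leeD => //; rewrite EFinM; apply: lee_wpmul2l.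
    move=> /le_trans; apply.
    have : c * delta <= e1; last by lra.
    apply: (@le_trans _ _ (c * (e1 / (c + 1)))).
      by rewrite ler_wpM2l// ge_min lexx orbT.
    by rewrite mulrCA ler_piMr ?(ltW e10)// ler_pdivrMr// mul1r; lra.
  have a2 : `|it n t (p j) x - it n (i%:R * tau) (p j) x| <= e1.
    have [Cj0 rj] := rate j.
    have nj : (n0 j <= n)%N by apply: leq_trans nn0; exact: leq_bigmax.
    have := smooth_time_regularity (pb j) Cj0 (rj n nj) (grid_ge0 i) it1 tT' x.
    rewrite /= -/Q => H.
    have H1 : `|it n t (p j) x - it n (i%:R * tau) (p j) x| * m <=
        Q * (Cs * (tau + tau)).
      apply: le_trans (ler_wpM2l (normr_ge0 _) (mP x xL)) _; apply: le_trans H _.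
      have hn0 := h_gt0 n; have hnt := hN1 n nN1; rewrite /= in hnt.
      by rewrite ler_wpM2l// ler_pM//; lra.
    rewrite -(ler_pM2r m0); apply: le_trans H1 _.
    rewrite (_ : _ * _ = (Q * Cs * 2) * tau); last by ring.
    rewrite /tau mulrCA ler_piMr ?mulr_ge0 ?(ltW e0) ?(ltW e10) ?(ltW m0)//.
    by rewrite ler_pdivrMr// mul1r; lra.
  have a3 : `|S (i%:R * tau) (p j) x - it n (i%:R * tau) (p j) x| <= e1.
    apply: (N2P (j, i)) => //; apply: leq_trans nN2.
    exact: (leq_bigmax (j, i)).
  rewrite distrC in a3.
  have := ler_distD (it n t (p j) x) (it n t f x) (S (i%:R * tau) (p j) x).
  have := ler_distD (it n (i%:R * tau) (p j) x) (it n t (p j) x) (S (i%:R * tau) (p j) x).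
  lra.
exists N => n f t x Nn fr tT xL; have /andP[t0 tT'] := tT.
have [j [fp pf]] := dense f fr.
have q0 : 0 <= t / tau by rewrite divr_ge0// ltW.
have iM : (Num.truncn (t / tau) < Mt.+1)%N.
  rewrite ltnS truncn_ge_nat; last exact: divr_ge0 T0 (ltW tau0).
  apply: (@le_trans _ _ (t / tau)); first by rewrite -truncn_ge_nat.
  by rewrite ler_wpM2r ?invr_ge0 ?(ltW tau0).
have /andP[i1 i2] := truncn_itv q0.
move: i1 i2; rewrite ler_pdivlMr// ltr_pdivrMr// -natr1 mulrDl mul1r => i1 /ltW i2.
have fC := hle_Ck kappa_cont kappa_gt0 alpha_gt0 fr.
(* The semigroup at [f] is reached through one more, larger index, to which the
   comparison applies as well. *)
have [N3 N3P] := mixed_cvg_uniform L (S_lim t0 fC) e10.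
have k1 := key n f t x j (Ordinal iM) Nn fr tT xL fp pf i1 i2.
have k2 := key (maxn N N3) f t x j (Ordinal iM) (leq_maxl _ _) fr tT xL fp pf i1 i2.
have k3 := N3P (maxn N N3) x (leq_maxr _ _) xL.
rewrite distrC in k1.
have := ler_distD (it (maxn N N3) t f x) (S t f x) (it n t f x).
have := ler_distD (S ((Ordinal iM)%:R * tau) (p j) x) (it (maxn N N3) t f x) (it n t f x).
rewrite /e1 in k1 k2 k3 *; lra.
Qed.

(** Weighted Hoelder bounds pass to locally uniform limits. *)
Lemma hle_limit (kap f : E -> R) (c : R) : (forall x, 0 < kap x) ->
  (forall L e : R, 0 < e -> exists g, hle alpha kap g c /\
     forall x, `|x| <= L -> `|f x - g x| <= e) ->
  hle alpha kap f c.
Proof.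
move=> k0 H; split=> [x|x y].
  apply/ler_addgt0Pr => e e0.
  have [g [[gc _] fg]] := H `|x| _ (divr_gt0 e0 (k0 x)).
  have := fg x (lexx _); rewrite ler_pdivlMr// => H1.
  have := ler_normD (f x - g x) (g x); rewrite subrK.
  move=> /(ler_wpM2r (ltW (k0 x))); rewrite mulrDl.
  have := gc x; lra.
have kb := kbar_gt0 x y k0.
apply/ler_addgt0Pr => e e0.
have e2 : 0 < e / kbar kap x y / 2 by apply: divr_gt0 => //; exact: divr_gt0.
have [g [[_ gc] fg]] := H (Num.max `|x| `|y|) _ e2.
have h1 := fg x; have h2 := fg y.
rewrite le_max lexx in h1; rewrite le_max lexx orbT in h2.
have {}h1 := h1 isT; have {}h2 := h2 isT.
have h3 : `|f x - f y| <= `|g x - g y| + e / kbar kap x y.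
  have := ler_distD (g x) (f x) (f y).
  have := ler_distD (g y) (g x) (f y).
  rewrite (distrC (g y)); lra.
apply: le_trans (ler_wpM2r (ltW kb) h3) _; rewrite mulrDl divfK ?gt_eqF//.
by rewrite lerD2r.
Qed.

Lemma semigroup_hle f r (t T : R) : 0 <= t <= T -> hle alpha kappa f r ->
  hle alpha kappa (S t f) (expR (omega * T) * r).
Proof.
move=> tT fr; have /andP[t0 _] := tT.
apply: hle_limit => // L e e0.
have fC := hle_Ck kappa_cont kappa_gt0 alpha_gt0 fr.
have [N NP] := mixed_cvg_uniform L (S_lim t0 fC) e0.
exists (it N t f); split; last by move=> x; exact: NP.
exact: (iter_pi_hle kappa_cont kappa_gt0 etan_ge0 h_gt0 alpha_gt0 env stability
  (J0 N) (@JE N) tT fr).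
Qed.

(** For a dominated weight, uniform convergence on compact sets and the uniform
    Hoelder bound give convergence in the weaker Hoelder norm. *)
Lemma hoelder_convergence (kappa' : E -> R) (r T alpha' e : R) :
  0 <= r -> 0 <= T -> 0 <= alpha' < alpha ->
  bounded_weight kappa' -> weight_ll kappa' kappa -> 0 < e ->
  (exists2 C : R, 0 < C & forall z, kappa' z <= C * kappa z) /\
  exists n, forall f t, hle alpha kappa f r -> 0 <= t <= T ->
    hle alpha' kappa' (S t f \- it n t f) e.
Proof.
move=> r0 T0 aa [_ k0' [D' kD']] kk e0.
have D'0 : 0 < D' by apply: lt_le_trans (kD' 0).
(* The ratio of the weights is below 1 far away, and bounded on a ball. *)
have [C C0 CP] : exists2 C : R, 0 < C & forall z, kappa' z <= C * kappa z.
  have [M MP] := kk 1 ltr01.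
  pose M' := Num.max 0 M; have M'0 : 0 <= M' by rewrite le_max lexx.
  have [m m0 mP] := weight_min kappa_cont kappa_gt0 M'0.
  exists (D' / m + 1) => [|z]; first by rewrite addr_gt0// divr_gt0.
  have kz := kappa_gt0 z.
  have [zM|zM] := leP (enorm z) M.
    have zm : m <= kappa z.
      apply: mP; apply: le_trans (normr_le_enorm z) _.
      by apply: le_trans zM _; rewrite le_max lexx orbT.
    apply: le_trans (kD' z) _; rewrite mulrDl mul1r -[leLHS]addr0 lerD ?(ltW kz)//.
    by rewrite mulrAC ler_pdivlMr// ler_wpM2l// ltW.
  have := MP z zM; rewrite ger0_norm; last by rewrite divr_ge0// ltW.
  rewrite ltr_pdivrMr// mul1r => /ltW /le_trans; apply.
  by rewrite ler_peMl ?(ltW kz)// lerDr divr_ge0// ltW.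
split; first by exists C.
pose A := expR (omega * T) * r + expR (omega * T) * r.
have A0 : 0 <= A by rewrite addr_ge0// mulr_ge0// expR_ge0.
have CA0 : 0 <= C * A by rewrite mulr_ge0// ltW.
have [eps eps0 Heps] := @hle_interpolation R d _ _ _ _ aa CA0 e0.
have A1 : 0 < A + 1 by lra.
have [M MP] := kk _ (divr_gt0 eps0 A1).
pose L := Num.max 0 M; have L0 : 0 <= L by rewrite le_max lexx.
have [N NP] := uniform_convergence r0 T0 L0 (divr_gt0 eps0 D'0).
exists N => f t fr tT.
have gA : hle alpha kappa (S t f \- it N t f) A.
  apply: hle_sub => //; first exact: semigroup_hle.
  exact: (iter_pi_hle kappa_cont kappa_gt0 etan_ge0 h_gt0 alpha_gt0 env stability
    (J0 N) (@JE N) tT fr).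
apply: Heps => //; last exact: hle_weight gA.
move=> x; have kx := kappa_gt0 x; have [xM|xM] := leP (enorm x) M.
  have xL : `|x| <= L.
    apply: le_trans (normr_le_enorm x) _.
    by apply: le_trans xM _; rewrite le_max lexx orbT.
  apply: (@le_trans _ _ (eps / D' * D')); last by rewrite divfK// gt_eqF.
  by apply: ler_pM => //; [exact: ltW|exact: NP].
have := MP x xM; rewrite ger0_norm; last by rewrite divr_ge0// ltW.
rewrite ltr_pdivrMr// => /ltW kx'.
apply: le_trans (ler_wpM2l (normr_ge0 _) kx') _.
rewrite mulrCA; apply: le_trans (ler_wpM2l _ (gA.1 x)) _.
  by rewrite divr_ge0// ltW.
by rewrite -mulrA ler_piMr ?(ltW eps0)// mulrC ler_pdivrMr// mul1r; lra.
Qed.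

End Convergence.

(** * Approximation of the iterates and of the semigroup *)

Section HoelderSums.
Context {R : realType} {d : nat}.
Local Notation E := 'rV[R]_d.

Lemma hle_trans (alpha : R) (kappa f g k : E -> R) (c c' : R) :
  (forall x, 0 < kappa x) -> hle alpha kappa (f \- k) c ->
  hle alpha kappa (k \- g) c' -> hle alpha kappa (f \- g) (c + c').
Proof.
move=> k0 fk [kg1 kg2].
have gk : hle alpha kappa (g \- k) c'.
  split=> [x|x y] /=; first by rewrite distrC; exact: kg1.
  have -> : g x - k x - (g y - k y) = - ((k x - g x) - (k y - g y)) by ring.
  by rewrite normrN; exact: kg2.
rewrite (_ : f \- g = (f \- k) \- (g \- k)); first exact: hle_sub.
by apply/funext => x /=; ring.
Qed.

Lemma hoelder_sup_lt (alpha : R) (kappa : E -> R) (e T : R)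
    (B : set (E -> R)) (u : (E -> R) -> R -> E -> R) :
  (forall x, 0 < kappa x) -> 0 < e ->
  (forall f t, B f -> 0 <= t <= T -> hle alpha kappa (u f t) (e / 2)) ->
  (ereal_sup [set ereal_sup [set hoelder_norm alpha kappa (u f t)
     | t in `[0%R, T]%classic] | f in B] < e%:E)%E.
Proof.
move=> k0 e0 H; apply: (@le_lt_trans _ _ (e / 2)%:E); last first.
  by rewrite lte_fin ltr_pdivrMr// ltr_pMr//; lra.
apply: ge_ereal_sup => _ [f Bf <-]; apply: ge_ereal_sup => _ [t tT <-].
by apply/hoelder_leP => //; apply: H => //; move: tT; rewrite /= in_itv.
Qed.

End HoelderSums.

Unset Implicit Arguments.

Theorem theorem4p7 (R : realType) (d : nat) (Lambda : Type)
  (kappa : 'rV[R]_d -> R)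
  (I : nat -> Lambda -> ('rV[R]_d -> R) -> ('rV[R]_d -> R))
  (etan : nat -> Lambda -> \bar R) (eta : Lambda -> \bar R) (h : nat -> R)
  (lambda0 : nat -> Lambda) (omega alpha : R)
  (d_gt0 : (0 < d)%N)
  (kappa_weight : bounded_weight kappa)
  (kappa_shift : shift_bounded kappa)
  (I_Ck : forall n l, maps_Ck kappa (I n l))
  (etan_ge0 : forall n l, (0 <= etan n l)%E)
  (eta_ge0 : forall l, (0 <= eta l)%E)
  (h_gt0 : forall n, 0 < h n)
  (h_cvg0 : h @ \oo --> (0 : R))
  (alpha_itv : 0 < alpha <= 1)
  (envelope : envelope_conditions kappa I etan eta h lambda0 omega)
  (stability : hoelder_stable kappa I h omega alpha)
  (compactness : parameter_compact kappa I etan h lambda0 alpha) :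
  (forall (r T : R) (n : nat) (alpha' e : R),
     0 <= r -> 0 <= T -> 0 <= alpha' < alpha -> 0 < e ->
     exists2 Phi : ('rV[R]_d -> R) -> ('rV[R]_d -> R),
       envelope_neural kappa I lambda0 n Phi &
       (ereal_sup [set ereal_sup [set hoelder_norm alpha' kappa
             (iter_pi h (Iop I etan h n) n t f \- iter_pi h Phi n t f)%R
           | t in `[0%R, T]%classic]
         | f in ball_Calpha alpha kappa r] < e%:E)%E)
  /\
  (forall S : R -> ('rV[R]_d -> R) -> ('rV[R]_d -> R),
     (forall t f, 0 <= t -> Ck kappa f ->
        mixed_cvg kappa (fun n => iter_pi h (Iop I etan h n) n t f) (S t f)) ->
     forall (r T alpha' : R) (kappa' : 'rV[R]_d -> R) (e : R),
       0 <= r -> 0 <= T -> 0 <= alpha' < alpha ->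
       bounded_weight kappa' -> weight_ll kappa' kappa -> 0 < e ->
       exists (n : nat) (Phi : ('rV[R]_d -> R) -> ('rV[R]_d -> R)),
         envelope_neural kappa I lambda0 n Phi /\
         (ereal_sup [set ereal_sup [set hoelder_norm alpha' kappa'
               (S t f \- iter_pi h Phi n t f)%R
             | t in `[0%R, T]%classic]
           | f in ball_Calpha alpha kappa r] < e%:E)%E).
Proof.
have kappa_gt0 : forall x, 0 < kappa x by case: kappa_weight.
have kappa_cont : continuous kappa by case: kappa_weight.
have env : envelope_common kappa I etan h lambda0 omega by case: envelope.
have alpha_gt0 : 0 < alpha by case/andP: alpha_itv.
have approx := neural_approx kappa_cont kappa_gt0 I_Ck etan_ge0 h_gt0 alpha_gt0 env
  stability compactness.
split.
  move=> r T n alpha' e r0 T0 aa e0.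
  have [Phi nPhi PhiP] := approx n r T alpha' _ r0 T0 aa (divr_gt0 e0 (ltr0n _ 2)).
  exists Phi => //; apply: hoelder_sup_lt => // f t /(ball_CalphaP kappa_gt0 _ _ alpha_gt0) fr tT.
  exact: PhiP.
move=> S S_lim r T alpha' kappa' e r0 T0 aa kw' kk e0.
have kappa'_gt0 : forall x, 0 < kappa' x by case: kw'.
have e4 : 0 < e / 4 by rewrite divr_gt0.
have [[C C0 CP] [n nP]] := hoelder_convergence kappa_weight etan_ge0 h_gt0 h_cvg0
  alpha_itv envelope stability S_lim r0 T0 aa kw' kk e4.
have [Phi nPhi PhiP] := approx n r T alpha' _ r0 T0 aa (divr_gt0 e4 C0).
exists n, Phi; split=> //; apply: hoelder_sup_lt => // f t /(ball_CalphaP kappa_gt0 _ _ alpha_gt0) fr tT.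
have H1 := nP f t fr tT.
have H2 := hle_weight C0 kappa_gt0 kappa'_gt0 CP (PhiP f t fr tT).
have -> : e / 2 = e / 4 + C * (e / 4 / C) by field; rewrite gt_eqF.
exact: hle_trans H1 H2.
Qed.
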